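(* Let $L$ be a finitely generated $R$-module. Then, for almost all $\alpha$, (i) $\operatorname{Ann} L_\alpha=(\operatorname{Ann} L)_\alpha$; (ii) $\dim L_\alpha=\dim L$.
   Context: Let $k$ be an arbitrary infinite field, $u=(u_1,\ldots,u_m)$ and $x=(x_1,\ldots,x_n)$ indeterminates, and $R=k(u)[x]$. Let $K$ be an extension field of $k$; for $\alpha\in K^m$ put $R_\alpha=k(\alpha)[x]$. A property holds for almost all $\alpha$ if it holds for all $\alpha\in K^m$ except perhaps those lying on a proper algebraic subvariety of $K^m$ (which may depend on the given data). Every $a\in R$ can be written $a(u,x)=p(u,x)/q(u)$ with $p\in k[u,x]$, $q\in k[u]\setminus\{0\}$; for $\alpha$ with $q(\alpha)\neq 0$ put $a(\alpha,x)=p(\alpha,x)/q(\alpha)\in R_\alpha$. For a matrix $A=(a_{ij}(u,x))$ over $R$ put $A_\alpha=(a_{ij}(\alpha,x))$; this is defined for almost all $\alpha$. The specialization $F_\alpha$ of a free $R$-module $F$ of finite rank is a free $R_\alpha$-module of the same rank. With bases fixed, the specialization $\phi_\alpha:F_\alpha\to G_\alpha$ of a homomorphism $\phi:F\to G$ of free $R$-modules of finite ranks with matrix $A$ is the homomorphism with matrix $A_\alpha$. Each finitely generated $R$-module $L$ is considered together with a fixed (arbitrary) finite free presentation $F_1\xrightarrow{\phi}F_0\to L\to 0$ (free modules of finite ranks), and its specialization is $L_\alpha:=\operatorname{Coker}\phi_\alpha$. For an ideal $I$ of $R$, the specialization $I_\alpha$ is the ideal of $R_\alpha$ generated by $\{f(\alpha,x)\mid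 f(u,x)\in I\cap k[u,x]\}$. $\operatorname{Ann}$ denotes the annihilator and $\dim$ the Krull dimension of a module. *)

(* Defs.v *)
From HB Require Import structures.
From mathcomp Require Import all_boot all_order all_algebra.
From mathcomp Require Import generic_quotient ring_quotient fraction mpoly.
From mathcomp Require Import boolp classical_sets cardinality constructive_ereal.

Set Implicit Arguments.
Unset Strict Implicit.
Unset Printing Implicit Defensive.

Import Order.TTheory GRing.Theory Num.Theory.
Local Open Scope quotient_scope.
Local Open Scope classical_set_scope.
Local Open Scope ring_scope.

(* Not [idealr_closed]: that one excludes the unit ideal. *)
Definition is_ideal (S : comNzRingType) (I : set S) : Prop :=
  GRing.submod_closed (fun x : S^o => x \in I).

Definition is_prime_ideal (S : comNzRingType) (P : set S) : Prop :=
  idealr_closed (fun x : S => x \in P) /\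
  prime_idealr_closed (fun x : S => x \in P).

Definition ideal_gen (S : comNzRingType) (X : set S) : set S :=
  smallest (@is_ideal S) X.

Definition Ann (S : comNzRingType) (M : lmodType S) : set S :=
  [set a | forall x : M, a *: x = 0].

Definition has_prime_chain (S : comNzRingType) (I : set S) (l : nat) : Prop :=
  exists P : 'I_l.+1 -> set S,
    (forall i, is_prime_ideal (P i) /\ I `<=` P i) /\
    (forall i j : 'I_l.+1, (i < j)%N -> P i `<` P j).

(* Krull dimension of [S / Ann M], whose primes are those of [S] containing
   [Ann M]: it is [-oo] for [M = 0], and [+oo] when chains are unbounded. *)
Definition module_dim (S : comNzRingType) (M : lmodType S) : \bar int :=
  supremum -oo%E [set (l%:Z)%:E%E | l in has_prime_chain (Ann M)].

Section Cokernel.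
Variables (S : comNzRingType) (t s : nat) (A : 'M[S]_(t, s)).

(* Matrices act on row vectors: [A] is the map [v |-> v *m A]. *)
Definition row_image : {pred 'rV[S]_s} :=
  fun w => `[< exists v : 'rV[S]_t, w = v *m A >].

Lemma row_imageP w : reflect (exists v, w = v *m A) (w \in row_image).
Proof. exact: asboolP. Qed.

Lemma row_image_submod : GRing.submod_closed row_image.
Proof.
split; first by apply/row_imageP; exists 0; rewrite mul0mx.
move=> a _ _ /row_imageP[v ->] /row_imageP[w ->]; apply/row_imageP.
by exists (a *: v + w); rewrite mulmxDl scalemxAl.
Qed.

HB.instance Definition _ :=
  GRing.isSubmodClosed.Build S 'rV[S]_s row_image
    (GRing.submod_closed_semi row_image_submod).

Definition coker := Quotient.quot row_image.
HB.instance Definition _ := GRing.Zmodule.on coker.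

Definition coker_pi (v : 'rV[S]_s) : coker := \pi_coker v.

Definition coker_scale (a : S) (x : coker) : coker := coker_pi (a *: repr x).

Lemma coker_pi_eq v w : (coker_pi v == coker_pi w) = (v - w \in row_image).
Proof. by rewrite -(Quotient.idealrBE row_image). Qed.

Lemma coker_piD v w : coker_pi (v + w) = coker_pi v + coker_pi w.
Proof. by rewrite /coker_pi raddfD. Qed.

Lemma coker_piZ a v : coker_pi (a *: v) = coker_scale a (coker_pi v).
Proof.
apply/eqP; rewrite coker_pi_eq -scalerBr rpredZ //.
by rewrite -coker_pi_eq /coker_pi reprK.
Qed.

Lemma coker_ind (P : coker -> Prop) : (forall v, P (coker_pi v)) -> forall x, P x.
Proof. by move=> Ppi x; rewrite -[x]reprK; apply: Ppi. Qed.

Lemma coker_scaleA a b x :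
  coker_scale a (coker_scale b x) = coker_scale (a * b) x.
Proof. by elim/coker_ind: x => v; rewrite -!coker_piZ scalerA. Qed.

Lemma coker_scale1 : left_id 1 coker_scale.
Proof. by elim/coker_ind=> v; rewrite -coker_piZ scale1r. Qed.

Lemma coker_scaleDr : right_distributive coker_scale +%R.
Proof.
move=> a; elim/coker_ind=> v; elim/coker_ind=> w.
by rewrite -coker_piD -!coker_piZ scalerDr coker_piD.
Qed.

Lemma coker_scaleDl x : {morph coker_scale^~ x : a b / a + b}.
Proof.
by elim/coker_ind: x => v a b; rewrite -!coker_piZ scalerDl coker_piD.
Qed.

HB.instance Definition _ := GRing.Zmodule_isLmodule.Build S coker
  coker_scaleA coker_scale1 coker_scaleDr coker_scaleDl.

End Cokernel.

(* Exactness of [S^t --A--> S^s --pi--> L --> 0]. *)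
Definition is_presentation (S : comNzRingType) (t s : nat) (A : 'M[S]_(t, s))
    (L : lmodType S) (pi : {linear 'rV[S]_s -> L}) : Prop :=
  (forall y : L, exists v, pi v = y) /\
  (forall v, pi v = 0 <-> exists w : 'rV[S]_t, v = w *m A).

Definition algebraic_set (K : fieldType) (m : nat) (F : set {mpoly K[m]}) :
    set ('I_m -> K) :=
  [set alpha | forall f, F f -> f.@[alpha] = 0].

Definition almost_all (K : fieldType) (m : nat) (P : ('I_m -> K) -> Prop) : Prop :=
  exists F : set {mpoly K[m]},
    algebraic_set F <> setT /\ forall alpha, ~ algebraic_set F alpha -> P alpha.

Section Adjunction.
Variables (k K : fieldType) (iota : {rmorphism k -> K}) (m : nat).
Variable alpha : 'I_m -> K.

(* The smallest subfield of [K] containing the image of [k] and all [alpha i]. *)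
Definition in_adjoin : {pred K} := fun x =>
  `[< forall F : {pred K}, GRing.divring_closed F ->
        (forall c, iota c \in F) -> (forall i, alpha i \in F) -> x \in F >].

Lemma in_adjoinP x :
  reflect (forall F : {pred K}, GRing.divring_closed F ->
             (forall c, iota c \in F) -> (forall i, alpha i \in F) -> x \in F)
          (x \in in_adjoin).
Proof. exact: asboolP. Qed.

Lemma in_adjoin_divring : GRing.divring_closed in_adjoin.
Proof.
split.
- by apply/in_adjoinP => F [].
- move=> x y /in_adjoinP Hx /in_adjoinP Hy; apply/in_adjoinP => F HF Hc Ha.
  by case: (HF) => _ HB _; apply: HB; [apply: Hx | apply: Hy].
- move=> x y /in_adjoinP Hx /in_adjoinP Hy; apply/in_adjoinP => F HF Hc Ha.
  by case: (HF) => _ _ HB; apply: HB; [apply: Hx | apply: Hy].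
Qed.

HB.instance Definition _ :=
  GRing.isDivringClosed.Build K in_adjoin in_adjoin_divring.

Record adjoin := Adjoin { adjoin_val :> K; _ : adjoin_val \in in_adjoin }.

HB.instance Definition _ := [isSub for adjoin_val].
HB.instance Definition _ := [Choice of adjoin by <:].
HB.instance Definition _ := [SubChoice_isSubIntegralDomain of adjoin by <:].
HB.instance Definition _ := [SubIntegralDomain_isSubField of adjoin by <:].

Lemma in_adjoin_base c : iota c \in in_adjoin.
Proof. by apply/in_adjoinP. Qed.

Lemma in_adjoin_gen i : alpha i \in in_adjoin.
Proof. by apply/in_adjoinP. Qed.

Definition adjoin_base (c : k) : adjoin := Adjoin (in_adjoin_base c).
Definition adjoin_gen (i : 'I_m) : adjoin := Adjoin (in_adjoin_gen i).

Lemma adjoin_base_is_zmod_morphism : zmod_morphism adjoin_base.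
Proof. by move=> x y; apply: val_inj; rewrite /= !rmorphB. Qed.

Lemma adjoin_base_is_monoid_morphism : monoid_morphism adjoin_base.
Proof.
by split=> [|x y]; apply: val_inj; rewrite /= ?rmorph1 ?rmorphM.
Qed.

HB.instance Definition _ :=
  GRing.isZmodMorphism.Build k adjoin adjoin_base adjoin_base_is_zmod_morphism.
HB.instance Definition _ :=
  GRing.isMonoidMorphism.Build k adjoin adjoin_base adjoin_base_is_monoid_morphism.

End Adjunction.

(* [k(u)[x]], and its special fibre [k(alpha)[x]]. *)
Definition genring (k : fieldType) (m n : nat) : comNzRingType :=
  {mpoly {fraction {mpoly k[m]}}[n]}.

Definition specring (k K : fieldType) (iota : {rmorphism k -> K}) (m n : nat)
    (alpha : 'I_m -> K) : comNzRingType :=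
  {mpoly (adjoin iota alpha)[n]}.

Section Specialization.
Variables (k K : fieldType) (iota : {rmorphism k -> K}) (m n : nat).

(* [k[u,x]] is encoded as [k[u][x]]. *)
Definition poly_in_genring (p : {mpoly {mpoly k[m]}[n]}) : genring k m n :=
  map_mpoly (@tofrac {mpoly k[m]}) p.

Variable alpha : 'I_m -> K.

Definition eval_u (q : {mpoly k[m]}) : adjoin iota alpha :=
  mmap (adjoin_base iota alpha) (adjoin_gen iota alpha) q.

Definition spec_poly (p : {mpoly {mpoly k[m]}[n]}) : specring iota n alpha :=
  map_mpoly eval_u p.

Definition is_spec (a : genring k m n) (b : specring iota n alpha) : Prop :=
  exists (p : {mpoly {mpoly k[m]}[n]}) (q : {mpoly k[m]}),
    [/\ q != 0, a = ((tofrac q)^-1)%:MP * poly_in_genring p,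
        eval_u q != 0 & b = ((eval_u q)^-1)%:MP * spec_poly p].

(* The value [b] in [is_spec] does not depend on the fraction chosen;
   [spec] has the junk value [0] where [a] is not defined at [alpha]. *)
Definition spec_defined (a : genring k m n) : Prop := exists b, is_spec a b.

Definition spec (a : genring k m n) : specring iota n alpha :=
  xget 0 [set b | is_spec a b].

Definition spec_mx_defined (t s : nat) (A : 'M[genring k m n]_(t, s)) : Prop :=
  forall i j, spec_defined (A i j).

Definition spec_mx (t s : nat) (A : 'M[genring k m n]_(t, s)) :
  'M[specring iota n alpha]_(t, s) := map_mx spec A.

Definition spec_ideal (I : set (genring k m n)) : set (specring iota n alpha) :=
  ideal_gen [set spec_poly f | f in [set f | I (poly_in_genring f)]].

(* The specialization of the module presented by [A]. *)
Definition spec_module (t s : nat) (A : 'M[genring k m n]_(t, s)) :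
  lmodType (specring iota n alpha) := coker (spec_mx A).

End Specialization.

Arguments eval_u {k K} iota {m} alpha q.
Arguments spec_poly {k K} iota {m n} alpha p.
Arguments spec_defined {k K} iota {m n} alpha a.
Arguments spec {k K} iota {m n} alpha a.
Arguments spec_mx_defined {k K} iota {m n} alpha {t s} A.
Arguments spec_mx {k K} iota {m n} alpha {t s} A.
Arguments spec_ideal {k K} iota {m n} alpha I.
Arguments spec_module {k K} iota {m n} alpha {t s} A.

(* Main.v *)
(* Write D = k[u]. Everything that happens for almost all alpha happens where one
   nonzero g in D does not vanish. By Dickson's lemma a D[x]-submodule U, observed
   through a linear form f, contains finitely many elements whose leading exponents
   divide all leading exponents of f(U); if g is a multiple of their leading
   coefficients, then division by them survives every specialization with
   g(alpha) <> 0. Hence specialization commutes with the kernel of f on U and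
   preserves the leading exponents of f(U). Iterating over the forms
   (a, V) |-> (a - V A)_ij gives the annihilator of the cokernel of A.

   For the dimension, an ideal I of F[x] has a chain of l + 1 primes above it if and
   only if some l variables support no leading exponent of I, and the leading
   exponents are those of the specialized ideal. Given a chain P_0 < ... < P_l and
   y_i in P_i outside P_(i-1), the monomials in the y_i are linearly independent
   modulo I, which yields at least c N^l standard monomials of degree at most N.
   Conversely, if F[Y] meets I in 0, take a prime P over I with F[Y] and P still
   meeting in 0, and Y maximal; then F[x]/P is algebraic over F[Y], and adding a
   suitable q in F[Y] to P costs only one variable of Y. *)
From HB Require Import structures.
Require Import Defs.
From mathcomp Require Import all_boot all_order all_algebra.
From mathcomp Require Import ring.
From mathcomp Require Import generic_quotient ring_quotient fraction ssrcomplements mpoly.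
From mathcomp Require Import boolp classical_sets cardinality constructive_ereal.

Set Implicit Arguments.
Unset Strict Implicit.
Unset Printing Implicit Defensive.

Import Order.TTheory GRing.Theory.
Local Open Scope quotient_scope.
Local Open Scope classical_set_scope.
Local Open Scope ring_scope.

(** * Division with generic coefficients *)

(** Comparing only the first [j] coordinates allows induction on [j] within one type of exponents.
    If [B] works for [j] and [J] bounds its entries at coordinate [j], then [B] handles the
    exponents whose entry there is at least [J]. The slices with entry [h < J] are finitely many,
    and each gets its own finite family [Bf h]. *)
Lemma dickson_prefix n j (E : set 'X_{1..n}) :
  exists2 B : seq 'X_{1..n}, {in B, forall b, E b} &
    forall e, E e -> exists2 b, b \in B &
      forall i : 'I_n, (i < j)%N -> (b i <= e i)%N.
Proof.
elim: j E => [|j IHj] E.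
  have [[e Ee]|noE] := pselect (exists e, E e).
    by exists [:: e] => [b|e' _]; [rewrite inE => /eqP-> | exists e; rewrite ?inE].
  by exists [::] => // e Ee; case: noE; exists e.
have [B BE HB] := IHj E.
have [ltjn|lenj] := ltnP j n; last first.
  exists B => // e /HB[b bB le_be]; exists b => // i _.
  by apply: le_be; apply: leq_trans lenj.
pose o := Ordinal ltjn.
have /choice[Bf HBf] h : exists B : seq 'X_{1..n},
    {in B, forall b, E b} /\ forall e, E e -> e o = h -> exists2 b, b \in B &
      b o = h /\ forall i : 'I_n, (i < j)%N -> (b i <= e i)%N.
  have [B1 B1E HB1] := IHj [set e | E e /\ e o = h].
  exists B1; split=> [b /B1E[]//|e Ee eo].
  by have [//|b bB1 le_be] := HB1 e; exists b => //; case: (B1E b bB1).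
pose J := \max_(b <- B) b o.
exists (B ++ flatten [seq Bf h | h <- iota 0 J]).
  move=> b; rewrite mem_cat => /orP[/BE//|/flatten_mapP[h _ bB]].
  by case: (HBf h) => + _; apply.
move=> e Ee; have [ltJ|leJ] := ltnP (e o) J.
  have [_ /(_ e Ee erefl)[b bB [bo le_be]]] := HBf (e o).
  exists b.
    rewrite mem_cat; apply/orP; right.
    by apply/flatten_mapP; exists (e o); rewrite ?mem_iota.
  move=> i; rewrite ltnS leq_eqVlt => /predU1P[ij|/le_be//].
  by rewrite (_ : i = o) ?bo//; apply: val_inj.
have [b bB le_be] := HB e Ee; exists b; first by rewrite mem_cat bB.
move=> i; rewrite ltnS leq_eqVlt => /predU1P[ij|/le_be//].
rewrite (_ : i = o); last exact: val_inj.
by apply: leq_trans leJ; rewrite /J (big_rem b)//= leq_maxl.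
Qed.

Lemma dickson n (E : set 'X_{1..n}) :
  exists2 B : seq 'X_{1..n}, {in B, forall b, E b} &
    forall e, E e -> exists2 b, b \in B & (b <= e)%MM.
Proof.
have [B BE HB] := dickson_prefix n E; exists B => // e /HB[b bB le_be].
by exists b => //; apply/mnm_lepP => i; apply: le_be.
Qed.

Lemma mlead_eq (R : nzRingType) n (p : {mpoly R[n]}) m : p@_m != 0 ->
  (forall m', (m < m')%O -> p@_m' = 0) -> p != 0 /\ mlead p = m.
Proof.
move=> pm0 Hp; have p0 : p != 0 by apply: contraNneq pm0 => ->; rewrite mcoeff0.
split=> //; apply/le_anti/andP; split.
  by rewrite leNgt; apply/negP => /Hp/eqP; rewrite mleadc_eq0 (negPf p0).
by apply: msupp_le_mlead; rewrite mcoeff_msupp.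
Qed.

(** * Submodules as sets, linear forms, and spans over the coefficient ring *)

Definition submodule (S : comNzRingType) (M : lmodType S) (U : set M) : Prop :=
  U 0 /\ forall a u v, U u -> U v -> U (a *: u + v).

Definition scalar_map (S : comNzRingType) (M : lmodType S) (f : M -> S) : Prop :=
  forall a u v, f (a *: u + v) = a * f u + f v.

Section SubmoduleTheory.
Variables (S : comNzRingType) (M : lmodType S).
Implicit Types (U : set M) (f : M -> S).

Lemma submodule0 U : submodule U -> U 0. Proof. by case. Qed.
Lemma submoduleZ U a u : submodule U -> U u -> U (a *: u).
Proof. by move=> [U0 UZ] Uu; rewrite -[_ *: _]addr0; apply: UZ. Qed.
Lemma submoduleD U u v : submodule U -> U u -> U v -> U (u + v).
Proof. by move=> [U0 UZ] Uu Uv; rewrite -[u]scale1r; apply: UZ. Qed.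
Lemma submoduleB U u v : submodule U -> U u -> U v -> U (u - v).
Proof. by move=> UU Uu Uv; rewrite -scaleN1r; apply: submoduleD => //; apply: submoduleZ. Qed.
Lemma submodule_sum U (I : Type) (r : seq I) (P : pred I) F :
  submodule U -> (forall i, P i -> U (F i)) -> U (\sum_(i <- r | P i) F i).
Proof.
move=> UU HF; elim/big_ind: _ => //; first exact: submodule0.
by move=> *; apply: submoduleD.
Qed.

Lemma scalar_map0 f : scalar_map f -> f 0 = 0.
Proof.
move=> fP; have := fP 1 0 0; rewrite scaler0 addr0 mul1r.
by move/(congr1 (fun x => x - f 0)); rewrite subrr addrK.
Qed.
Lemma scalar_mapZ f a u : scalar_map f -> f (a *: u) = a * f u.
Proof. by move=> fP; rewrite -[_ *: _]addr0 fP scalar_map0// addr0. Qed.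
Lemma scalar_mapD f u v : scalar_map f -> f (u + v) = f u + f v.
Proof. by move=> fP; rewrite -[u]scale1r fP mul1r scale1r. Qed.
Lemma scalar_mapB f u v : scalar_map f -> f (u - v) = f u - f v.
Proof. by move=> fP; rewrite -scaleN1r addrC fP mulN1r addrC. Qed.
Lemma scalar_map_sum f (I : Type) (r : seq I) (P : pred I) F :
  scalar_map f -> f (\sum_(i <- r | P i) F i) = \sum_(i <- r | P i) f (F i).
Proof.
by move=> fP; apply: (big_morph f _ (scalar_map0 fP)) => u v; apply: scalar_mapD.
Qed.

Lemma submodule_ker U f :
  submodule U -> scalar_map f -> submodule [set u | U u /\ f u = 0].
Proof.
move=> UU fP; split; first by split; [exact: submodule0 | exact: scalar_map0].
move=> a u v /= [Uu fu] [Uv fv]; split; first by case: UU => _; apply.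
by rewrite fP fu fv mulr0 addr0.
Qed.

End SubmoduleTheory.

Section LinearSum.
Variables (R : nzRingType) (n : nat) (M : lmodType {mpoly R[n]}).
Variable h : 'X_{1..n} -> M.

(** The extension of [h] from monomials that is linear over [R] only: the polynomial [d] merely
    records the coefficients of a combination. *)
Definition lsum (d : {mpoly R[n]}) : M := \sum_(m <- msupp d) (d@_m)%:MP *: h m.

Lemma lsumwE k d : (msize d <= k)%N ->
  lsum d = \sum_(m : 'X_{1..n < k}) (d@_m)%:MP *: h m.
Proof.
move=> le_dk; pose I := 'X_{1..n < k}.
rewrite /lsum (big_mksub I)/= ?msupp_uniq//; first last.
  by move=> x /msize_mdeg_lt /leq_trans; apply.
rewrite big_rmcond//= => i.
by move/memN_msupp_eq0 => ->; rewrite mpolyC0 scale0r.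
Qed.

Lemma lsumD d1 d2 : lsum (d1 + d2) = lsum d1 + lsum d2.
Proof.
pose k := maxn (maxn (msize d1) (msize d2)) (msize (d1 + d2)).
rewrite !(@lsumwE k) ?leq_max ?leqnn ?orbT// -big_split/=.
by apply: eq_bigr => m _; rewrite mcoeffD mpolyCD scalerDl.
Qed.

Lemma lsumZ c d : lsum (c *: d) = c%:MP *: lsum d.
Proof.
pose k := maxn (msize d) (msize (c *: d)).
rewrite !(@lsumwE k) ?leq_max ?leqnn ?orbT// scaler_sumr.
by apply: eq_bigr => m _; rewrite mcoeffZ mpolyCM scalerA.
Qed.

Lemma lsumX m : lsum 'X_[m] = h m.
Proof. by rewrite /lsum msuppX big_seq1 mcoeffX eqxx mpolyC1 scale1r. Qed.

Lemma lsum0 : lsum 0 = 0.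
Proof. by rewrite /lsum msupp0 big_nil. Qed.

End LinearSum.

(** Only constants are allowed as coefficients. The image of a submodule under a specialization need
    not be stable under all scalars of the target field; this span supplies them. *)
Inductive kspan (R : nzRingType) n (M : lmodType {mpoly R[n]}) (S : set M) : set M :=
  | kspan0 : kspan S 0
  | kspanD c v w : S v -> kspan S w -> kspan S (c%:MP *: v + w).

Section KSpan.
Variables (R : nzRingType) (n : nat) (M : lmodType {mpoly R[n]}).
Implicit Type S : set M.

Lemma kspan_incl S v : S v -> kspan S v.
Proof.
move=> Sv; rewrite -[v]addr0 -[v]scale1r -mpolyC1.
by apply: kspanD => //; apply: kspan0.
Qed.

Lemma kspan_add S v w : kspan S v -> kspan S w -> kspan S (v + w).
Proof.
by elim=> [|c u v' Su _ IH] kw; rewrite ?add0r// -addrA; apply: kspanD => //; apply: IH.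
Qed.

Lemma kspan_scale S c v : kspan S v -> kspan S (c%:MP *: v).
Proof.
elim=> [|a u w Su _ IH]; first by rewrite scaler0; apply: kspan0.
by rewrite scalerDr scalerA -mpolyCM; apply: kspanD.
Qed.

Lemma kspan_sum S (I : Type) (r : seq I) (P : pred I) F :
  (forall i, P i -> kspan S (F i)) -> kspan S (\sum_(i <- r | P i) F i).
Proof.
move=> HF; elim/big_ind: _ => //; first exact: kspan0.
by move=> *; apply: kspan_add.
Qed.

Lemma kspan_sub S1 S2 : S1 `<=` S2 -> kspan S1 `<=` kspan S2.
Proof.
by move=> s12 w; elim=> [|c u v Su _ IH]; [exact: kspan0 | apply: kspanD => //; apply: s12].
Qed.

End KSpan.

Definition lead_exps (R : nzRingType) n (M : Type) (f : M -> {mpoly R[n]})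
    (U : set M) : set 'X_{1..n} :=
  [set m | exists u, [/\ U u, f u != 0 & mlead (f u) = m]].

(** * Leading exponents under specialization *)

Section GenericLead.
Variables (D : idomainType) (n : nat) (M : lmodType {mpoly D[n]}).
Variables (f : M -> {mpoly D[n]}) (U : set M).
Hypotheses (fP : scalar_map f) (UU : submodule U).

(** Each [h m] is a monomial multiple of one of the finitely many elements given by Dickson's lemma,
    so only finitely many leading coefficients occur; [g] is their product. *)
Lemma lead_family : exists (h : 'X_{1..n} -> M) (g : D), g != 0 /\
  forall m, lead_exps f U m ->
    [/\ U (h m), mlead (f (h m)) = m & exists c, c * (f (h m))@_m = g].
Proof.
have [B BE HB] := dickson (lead_exps f U).
have /choice[ub Hub] b : exists u, lead_exps f U b ->
    [/\ U u, f u != 0 & mlead (f u) = b].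
  have [[u Hu]|nE] := pselect (lead_exps f U b); last by exists 0 => /nE.
  by exists u.
have /choice[bm Hbm] m : exists b, lead_exps f U m -> b \in B /\ (b <= m)%MM.
  have [/HB[b bB bm]|nE] := pselect (lead_exps f U m); last by exists 0%MM => /nE.
  by exists b.
pose lc b := (f (ub b))@_b.
have lc0 b : b \in B -> lc b != 0.
  by move=> /BE/Hub[_ fu fb]; rewrite /lc -{1}fb mleadc_eq0.
exists (fun m => 'X_[m - bm m] *: ub (bm m)), (\prod_(b <- undup B) lc b); split.
  by rewrite prodf_seq_neq0; apply/allP => b; rewrite mem_undup => /lc0.
move=> m Em; have [bB ble] := Hbm m Em; have [Uu fu fb] := Hub _ (BE _ bB).
have Elead : mlead (f ('X_[m - bm m] *: ub (bm m))) = m.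
  rewrite scalar_mapZ// mleadM ?mleadXm ?fb ?submK//.
  by rewrite -msupp_eq0 msuppX.
split=> //; first exact: submoduleZ.
exists (\prod_(b <- undup B | b != bm m) lc b).
rewrite mulrC [RHS](bigD1_seq (bm m)) ?undup_uniq ?mem_undup//=; congr (_ * _).
by rewrite scalar_mapZ// /lc mulrC -(mcoeffMX (f (ub (bm m))) (m - bm m) (bm m)) submK.
Qed.

(* [W] is larger than [U] when [U] is to be compared with its saturation. *)
Lemma pseudo_division h g (W : set M) : g != 0 ->
  (forall m, lead_exps f U m ->
    [/\ U (h m), mlead (f (h m)) = m & exists c, c * (f (h m))@_m = g]) ->
  submodule W -> U `<=` W -> lead_exps f W `<=` lead_exps f U ->
  forall w, W w -> exists e d u,
    [/\ {in msupp d, forall m, lead_exps f U m}, W u, f u = 0 &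
        (g ^+ e)%:MP *: w = lsum h d + u].
Proof.
move=> g0 Hh WW UW EWU w; have [m Hm] : {m | mlead (f w) = m} by exists (mlead (f w)).
elim/(@ltmwf n): m w Hm => m IH w Hm Ww.
have [fw0|fw0] := eqVneq (f w) 0.
  exists 0%N, 0, w; split=> //; first by move=> x; rewrite msupp0.
  by rewrite lsum0 add0r expr0 mpolyC1 scale1r.
have Em : lead_exps f U m by apply: EWU; exists w.
have [Uh fh [c Hc]] := Hh m Em.
(* The factor [c] turns the leading coefficient of [f (h m)] into [g], so the leading terms cancel
   in [f w']. *)
pose a := c * (f w)@_m.
pose w' := g%:MP *: w - a%:MP *: h m.
have Ww' : W w' by apply: submoduleB => //; apply: submoduleZ => //; apply: UW.
have Efw' : f w' = g%:MP * f w - a%:MP * f (h m) by rewrite scalar_mapB// !scalar_mapZ.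
have [e [d [u [dE Wu fu Eu]]]] : exists e d u,
    [/\ {in msupp d, forall m, lead_exps f U m}, W u, f u = 0 &
        (g ^+ e)%:MP *: w' = lsum h d + u].
  have [fw'0|fw'0] := eqVneq (f w') 0.
    exists 0%N, 0, w'; split=> //; first by move=> x; rewrite msupp0.
    by rewrite lsum0 add0r expr0 mpolyC1 scale1r.
  apply: (IH (mlead (f w'))) => //; rewrite ltNge; apply/negP => le_m.
  have := mleadc_eq0 (f w'); rewrite (negPf fw'0) => /negP; apply.
  rewrite Efw' mcoeffB !mcoeffCM -Efw'.
  move: le_m; rewrite le_eqVlt => /predU1P[<-|lt_m].
    by rewrite /a -mulrA [_ * (f (h m))@_m]mulrC mulrA Hc subrr.
  by rewrite (@mcoeff_gt_mlead _ _ (f w)) ?Hm//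
    (@mcoeff_gt_mlead _ _ (f (h m))) ?fh// !mulr0 subr0.
exists e.+1, (d + (g ^+ e * a) *: 'X_[m]), u; split=> //.
  move=> x /msuppD_le; rewrite mem_cat => /orP[/dE//|/msuppZ_le].
  by move/mem_msuppXP <-.
rewrite lsumD lsumZ lsumX addrAC -Eu /w' scalerBr !scalerA -!mpolyCM.
by rewrite subrK exprSr.
Qed.

(** Kernel and leading exponents are read off a normal form: a combination of the [Phi (h m)] plus
    an element spanned by the image of the kernel. The choice of [g] precedes that of the field, so
    one [g] serves all specializations. *)
Theorem generic_lead : exists2 g : D, g != 0 &
  forall (F : fieldType) (phi : {rmorphism D -> F}), phi g != 0 ->
  forall (M' : lmodType {mpoly F[n]}) (Phi : M -> M') (f' : M' -> {mpoly F[n]}),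
    (forall a u v, Phi (a *: u + v) = map_mpoly phi a *: Phi u + Phi v) ->
    scalar_map f' -> (forall u, f' (Phi u) = map_mpoly phi (f u)) ->
  [/\ forall w, kspan (Phi @` U) w -> f' w = 0 ->
        kspan (Phi @` [set u | U u /\ f u = 0]) w,
      forall w, kspan (Phi @` U) w -> f' w != 0 ->
        lead_exps f U (mlead (f' w)) &
      lead_exps f U `<=` lead_exps (f' \o Phi) U].
Proof.
have [h [g [g0 Hh]]] := lead_family; exists g => // F phi phig M' Phi f' PhiP f'P Hf'.
have Phi0 : Phi 0 = 0.
  have := PhiP 1 0 0; rewrite scaler0 addr0 rmorph1 scale1r.
  by move/(congr1 (fun x => x - Phi 0)); rewrite subrr addrK.
have PhiZ a u : Phi (a *: u) = map_mpoly phi a *: Phi u.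
  by rewrite -[_ *: _]addr0 PhiP Phi0 addr0.
have PhiD u v : Phi (u + v) = Phi u + Phi v.
  by rewrite -[u]scale1r PhiP rmorph1 !scale1r.
have mapC c : map_mpoly phi c%:MP_[n] = (phi c)%:MP_[n] by apply: map_mpolyC.
have mapE p m : (map_mpoly phi p)@_m = phi (p@_m) by apply: mcoeff_map_mpoly.
have h'P m : lead_exps f U m ->
    (f' (Phi (h m)))@_m != 0 /\ forall m', (m < m')%O -> (f' (Phi (h m)))@_m' = 0.
  move=> /Hh[_ fh [c Hc]]; rewrite Hf'; split.
    rewrite mapE; apply: contraNneq phig => fh0.
    by rewrite -Hc rmorphM fh0 mulr0.
  by move=> m' ltm; rewrite mapE mcoeff_gt_mlead ?fh// rmorph0.
have Phi_lsum d : Phi (lsum h d) = lsum (Phi \o h) (map_mpoly phi d).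
  pose k := maxn (msize d) (msize (map_mpoly phi d)).
  rewrite !(@lsumwE _ _ _ _ k) ?leq_max ?leqnn ?orbT//.
  rewrite (big_morph Phi PhiD Phi0); apply: eq_bigr => m _.
  by rewrite PhiZ mapC mapE.
(* Division of [u] introduces a power of [g], whose image is invertible in [F]. *)
have NF w : kspan (Phi @` U) w -> exists d u,
    [/\ {in msupp d, forall m, lead_exps f U m},
        kspan (Phi @` [set u | U u /\ f u = 0]) u & w = lsum (Phi \o h) d + u].
  elim=> [|c _ v [u Uu <-] _ [d [x [dE kx ->]]]].
    exists 0, 0; split; first by move=> m; rewrite msupp0.
      exact: kspan0.
    by rewrite lsum0 addr0.
  have [//|//|e [d' [u' [d'E Uu' fu' /(congr1 Phi)]]]] :=
    pseudo_division g0 Hh UU _ _ Uu.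
  rewrite PhiZ mapC rmorphXn PhiD Phi_lsum => Eu.
  pose b := c * (phi g ^+ e)^-1.
  have Ec : c%:MP *: Phi u = b%:MP *: ((phi g ^+ e)%:MP *: Phi u).
    by rewrite scalerA -mpolyCM /b divfK// expf_neq0.
  exists (b *: map_mpoly phi d' + d), (b%:MP *: Phi u' + x); split.
  - move=> m /msuppD_le; rewrite mem_cat => /orP[/msuppZ_le|/dE//].
    by rewrite mcoeff_msupp mapE => dm; apply: d'E;
       rewrite mcoeff_msupp; apply: contraNneq dm => ->; rewrite rmorph0.
  - by apply: kspanD => //; exists u'.
  - by rewrite Ec Eu lsumD lsumZ scalerDr addrACA.
have f'0 u : kspan (Phi @` [set u | U u /\ f u = 0]) u -> f' u = 0.
  elim=> [|c _ v [x [Ux fx] <-] _ IH]; first exact: scalar_map0.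
  by rewrite f'P IH Hf' fx rmorph0 mulr0 addr0.
(* The leading exponent of [f' (Phi (h m))] is exactly [m], so terms with different [m] cannot
   cancel at the top. *)
have lead_lsum d : d != 0 -> {in msupp d, forall m, lead_exps f U m} ->
    f' (lsum (Phi \o h) d) != 0 /\ mlead (f' (lsum (Phi \o h) d)) = mlead d.
  move=> d0 dE; rewrite scalar_map_sum//.
  apply: mlead_eq => [|m' ltm].
    rewrite raddf_sum (bigD1_seq (mlead d)) ?msupp_uniq ?mlead_supp//=.
    rewrite big_seq_cond big1 => [|m /andP[dm ne_m]].
      rewrite addr0 scalar_mapZ// mcoeffCM mulf_neq0 ?mleadc_eq0//.
      by case: (h'P _ (dE _ (mlead_supp d0))).
    have ltm : (m < mlead d)%O by rewrite lt_neqAle ne_m msupp_le_mlead.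
    by rewrite scalar_mapZ// mcoeffCM; case: (h'P _ (dE _ dm)) => _ ->; rewrite ?mulr0.
  rewrite raddf_sum big_seq big1//= => m dm.
  rewrite scalar_mapZ// mcoeffCM; case: (h'P _ (dE _ dm)) => _ ->; rewrite ?mulr0//.
  exact: le_lt_trans (msupp_le_mlead dm) ltm.
split.
- move=> w /NF[d [u [dE ku ->]]]; rewrite scalar_mapD// (f'0 u)// addr0 => fd.
  have [->|d0] := eqVneq d 0; first by rewrite lsum0 add0r.
  by have [] := lead_lsum d d0 dE; rewrite fd eqxx.
- move=> w /NF[d [u [dE ku ->]]]; rewrite scalar_mapD// (f'0 u)// addr0 => fd.
  have [d0|d0] := eqVneq d 0; first by rewrite d0 lsum0 scalar_map0 ?eqxx in fd.
  have [_ ->] := lead_lsum d d0 dE; exact/dE/mlead_supp.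
- move=> m Em; have [Uh _ _] := Hh m Em; have [hm Hm] := h'P m Em.
  by exists (h m); have [] := mlead_eq hm Hm.
Qed.

End GenericLead.
(** The saturation [W] of [U] has the same leading exponents as [U], since nonzero constant factors
    do not change them. Dividing [p] in [W] by elements of [U] therefore leaves no remainder, and
    powers of a single [g] replace all the constants [c]. *)
Lemma saturation_exponent (D : idomainType) n (U : set {mpoly D[n]}^o) :
  submodule U -> exists2 g : D, g != 0 &
    forall c p, c != 0 -> U (c%:MP * p) -> exists e, U ((g ^+ e)%:MP * p).
Proof.
move=> UU; have idP : @scalar_map _ {mpoly D[n]}^o id by [].
have sE (a b : {mpoly D[n]}) : a *: (b : {mpoly D[n]}^o) = a * b by [].
have [h [g [g0 Hh]]] := lead_family idP UU; exists g => // c p c0 Ucp.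
pose W : set {mpoly D[n]}^o := [set p | exists2 c : D, c != 0 & U (c%:MP * p)].
have WW : submodule W.
  split; first by exists 1; rewrite ?oner_eq0// mulr0; exact: (submodule0 UU).
  move=> a u v [cu cu0 Uu] [cv cv0 Uv]; exists (cu * cv); first exact: mulf_neq0.
  rewrite mulrDr; apply: (submoduleD UU).
    have E : (cu * cv)%:MP * (a *: u) = (a * cv%:MP) *: (cu%:MP * u : {mpoly D[n]}^o).
      by rewrite !sE mpolyCM; ring.
    by rewrite [X in U X]E; exact: (submoduleZ _ UU).
  have E : (cu * cv)%:MP * v = cu%:MP *: (cv%:MP * v : {mpoly D[n]}^o).
    by rewrite sE mpolyCM mulrA.
  by rewrite [X in U X]E; exact: (submoduleZ _ UU).
have UW : U `<=` W by move=> u Uu; exists 1; rewrite ?oner_eq0// mpolyC1 mul1r.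
have EW : lead_exps id W `<=` lead_exps id U.
  move=> m [u [[a a0 Uau] u0 <-]]; exists (a%:MP * u); split=> //.
    by rewrite mul_mpolyC mscalerI (negPf a0).
  by rewrite mul_mpolyC mleadZ.
have Wp : W p by exists c.
have [e [d [u [dE _ u0 E]]]] := pseudo_division idP g0 Hh WW UW EW Wp.
exists e; rewrite [X in U X]E u0 addr0 /lsum big_seq.
apply: (submodule_sum _ UU) => m /dE/Hh[Um _ _]; exact: (submoduleZ _ UU).
Qed.

(** One form at a time: by [generic_lead] the kernel of the first specialized form is spanned by the
    image of the original kernel, and the remaining forms are applied to that kernel. *)
Lemma generic_kernel (D : idomainType) n (M : lmodType {mpoly D[n]})
    (I : eqType) (f : I -> M -> {mpoly D[n]}) (r : seq I) (U : set M) :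
  (forall i, scalar_map (f i)) -> submodule U ->
  exists2 g : D, g != 0 &
  forall (F : fieldType) (phi : {rmorphism D -> F}), phi g != 0 ->
  forall (M' : lmodType {mpoly F[n]}) (Phi : M -> M') (f' : I -> M' -> {mpoly F[n]}),
    (forall a u v, Phi (a *: u + v) = map_mpoly phi a *: Phi u + Phi v) ->
    (forall i, scalar_map (f' i)) ->
    (forall i u, f' i (Phi u) = map_mpoly phi (f i u)) ->
  forall w, kspan (Phi @` U) w -> {in r, forall i, f' i w = 0} ->
    kspan (Phi @` [set u | U u /\ {in r, forall i, f i u = 0}]) w.
Proof.
move=> fP; elim: r U => [|i r IH] U UU.
  exists 1; rewrite ?oner_eq0// => F phi _ M' Phi f' _ _ _ w kw _.
  by apply: kspan_sub kw => _ [u Uu <-]; exists u.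
have [g1 g10 H1] := generic_lead (fP i) UU.
have [g2 g20 H2] := IH _ (submodule_ker UU (fP i)).
exists (g1 * g2); rewrite ?mulf_neq0// => F phi.
rewrite rmorphM mulf_eq0 negb_or => /andP[phi1 phi2] M' Phi f' PhiP f'P Hf' w kw fw.
have [K _ _] := H1 F phi phi1 M' Phi (f' i) PhiP (f'P i) (Hf' i).
have {}K := K w kw (fw i (mem_head _ _)).
have fwr : {in r, forall j, f' j w = 0} by move=> j jr; apply: fw; rewrite inE jr orbT.
apply: kspan_sub (H2 F phi phi2 M' Phi f' PhiP f'P Hf' w K fwr) => _ [u [[Uu fu] fru] <-].
exists u => //; split=> // j.
by rewrite inE => /predU1P[->//|/fru].
Qed.

(** The annihilator of the cokernel of [A], by [Ann_coker]: row [i] of [V] witnesses that [a] times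
    the [i]-th basis vector lies in the row image. *)
Definition mx_ann (S : comNzRingType) t s (A : 'M[S]_(t, s)) : set S :=
  [set a | exists V : 'M[S]_(s, t), a%:M = V *m A].

Lemma submodule_mx_ann (S : comNzRingType) t s (A : 'M[S]_(t, s)) :
  @submodule S S^o (mx_ann A).
Proof.
split; first by exists 0; rewrite mul0mx; apply/matrixP => i j; rewrite !mxE mul0rn.
move=> a u v [V EV] [W EW]; exists (a *: V + W).
by rewrite mulmxDl -scalemxAl -EV -EW raddfD/= scale_scalar_mx.
Qed.

Lemma map_mx_ann (S T : comNzRingType) (f : {rmorphism S -> T}) t s
    (A : 'M[S]_(t, s)) a :
  mx_ann A a -> mx_ann (map_mx f A) (f a).
Proof.
by move=> [V EV]; exists (map_mx f V); rewrite -map_mxM -EV map_scalar_mx.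
Qed.

Lemma kspan_map_mpoly (D : nzRingType) (F : fieldType) (phi : {rmorphism D -> F}) n
   (a : {mpoly F[n]}) : @kspan _ _ {mpoly F[n]}^o (map_mpoly phi @` setT) a.
Proof.
rewrite [a]mpolyE; apply: (@kspan_sum _ _ {mpoly F[n]}^o) => m _.
rewrite -mul_mpolyC; apply: (@kspan_scale _ _ {mpoly F[n]}^o).
by apply: kspan_incl; exists 'X_[m] => //; rewrite map_mpolyX.
Qed.

Lemma kspan_image (R : nzRingType) n (M M' : lmodType {mpoly R[n]})
    (S : set M) (S' : set M') (L : M -> M') v :
  L 0 = 0 -> (forall c u w, L (c%:MP *: u + w) = c%:MP *: L u + L w) ->
  (forall u, S u -> S' (L u)) -> kspan S v -> kspan S' (L v).
Proof.
move=> L0 LD SL; elim=> [|c u w Su _ IH]; first by rewrite L0; apply: kspan0.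
by rewrite LD; apply: kspanD => //; apply: SL.
Qed.

(** The pairs [(a, V)] with [a%:M = V *m A] are the common zeros of finitely many linear forms on a
    free module, so [generic_kernel] applies. In the other direction the constant [c] may vanish
    under [phi]; [saturation_exponent] replaces it by a power of [g2], which does not. *)
Theorem generic_annihilator (D : idomainType) n t s
    (A : 'M[{mpoly D[n]}]_(t, s)) :
  exists2 g : D, g != 0 &
  forall (F : fieldType) (phi : {rmorphism D -> F}), phi g != 0 ->
  forall a, mx_ann (map_mx (map_mpoly phi) A) a <->
    @kspan _ _ {mpoly F[n]}^o
      (map_mpoly phi @` [set p | exists2 c : D, c != 0 & mx_ann A (c%:MP * p)]) a.
Proof.
pose form (S : comNzRingType) (B : 'M[S]_(t, s)) (ij : 'I_s * 'I_s)
    (u : S^o * 'M[S]_(s, t)) : S :=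
  (u.1%:M - u.2 *m B) ij.1 ij.2.
have formP S B ij : scalar_map (@form S B ij).
  move=> a u v; rewrite /form/=.
  rewrite mulmxDl -scalemxAl raddfD/= -[a *: u.1]/(a * u.1) -scale_scalar_mx.
  by rewrite !mxE/=; ring.
have formE S B u : {in enum {: 'I_s * 'I_s}, forall ij, @form S B ij u = 0} <->
    u.1%:M = u.2 *m B.
  split=> [H|E ij _]; last by rewrite /form E subrr mxE.
  apply/eqP; rewrite -subr_eq0; apply/eqP/matrixP => i j.
  by rewrite [RHS]mxE; apply: (H (i, j)); rewrite mem_enum.
have [g1 g10 H1] := generic_kernel (enum {: 'I_s * 'I_s}) (formP _ A)
  (conj I (fun _ _ _ _ _ => I) : submodule setT).
have [g2 g20 H2] := saturation_exponent (submodule_mx_ann A).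
exists (g1 * g2); rewrite ?mulf_neq0// => F phi.
rewrite rmorphM mulf_eq0 negb_or => /andP[phi1 phi2] a; split.
  move=> [V EV].
  pose Phi (u : {mpoly D[n]}^o * 'M[{mpoly D[n]}]_(s, t)) :
    {mpoly F[n]}^o * 'M[{mpoly F[n]}]_(s, t) :=
    (map_mpoly phi u.1, map_mx (map_mpoly phi) u.2).
  have PhiP b u v : Phi (b *: u + v) = map_mpoly phi b *: Phi u + Phi v.
    by rewrite /Phi/= map_mxD map_mxZ -[b *: u.1]/(b * u.1) rmorphD rmorphM.
  have PhiE ij u : form _ (map_mx (map_mpoly phi) A) ij (Phi u) =
      map_mpoly phi (form _ A ij u).
    by rewrite /form/= -map_mxM -map_scalar_mx -map_mxB mxE.
  (* Splitting [V] into its entries shows that every pair over [F] is spanned by images of pairs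
     over [D]. *)
  have ka : kspan (Phi @` setT) (a, V).
    have -> : (a, V) = (a, 0) +
        \sum_i \sum_j (0, V i j *: delta_mx i j) :> {mpoly F[n]}^o * 'M[{mpoly F[n]}]_(s, t).
      apply/pair_eqP/andP; split; apply/eqP; rewrite /= ?raddf_sum/=.
        by rewrite big1 ?addr0// => i _; rewrite raddf_sum big1.
      rewrite add0r [LHS]matrix_sum_delta; apply: eq_bigr => i _.
      by rewrite raddf_sum.
    apply: kspan_add.
      apply: (kspan_image (L := fun x => (x, 0))) (kspan_map_mpoly phi a) => //.
        by move=> c u v; apply/pair_eqP/andP; split; apply/eqP; rewrite //= scaler0 addr0.
      by move=> _ [p _ <-]; exists (p, 0) => //; rewrite /Phi/= map_mx0.
    apply: kspan_sum => i _; apply: kspan_sum => j _.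
    apply: (kspan_image (L := fun x : {mpoly F[n]}^o =>
      (0 : {mpoly F[n]}^o, (x : {mpoly F[n]}) *: delta_mx i j))) (kspan_map_mpoly phi (V i j)).
    - by rewrite scale0r.
    - move=> c u v; apply/pair_eqP/andP; split; apply/eqP; rewrite /= ?scaler0 ?addr0//.
      by rewrite scalerDl scalerA.
    - move=> _ [p _ <-]; exists (0, p *: delta_mx i j) => //.
      by rewrite /Phi/= rmorph0 map_mxZ map_delta_mx.
  have fa := (formE _ (map_mx (map_mpoly phi) A) (a, V)).2 EV.
  have := H1 F phi phi1 _ Phi (form _ (map_mx (map_mpoly phi) A)) PhiP (formP _ _) PhiE
    (a, V) ka fa.
  apply: (@kspan_image _ _ _ {mpoly F[n]}^o _ _ fst) => // _ [[p W] [_ /formE EW] <-].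
  by exists p => //; exists 1; rewrite ?oner_eq0// mpolyC1 mul1r; exists W.
move=> ka; elim: ka => [|c _ v [p [b b0 Ap] <-] _ IH].
  by apply: submodule0; apply: submodule_mx_ann.
apply: (submoduleD (submodule_mx_ann _)) => //.
have [e /(map_mx_ann (map_mpoly phi))] := H2 b p b0 Ap.
rewrite rmorphM /= map_mpolyC => K.
have -> : c%:MP *: (map_mpoly phi p : {mpoly F[n]}^o) =
    (c / phi (g2 ^+ e))%:MP *: ((phi (g2 ^+ e))%:MP * map_mpoly phi p : {mpoly F[n]}^o).
  rewrite /GRing.scale/= mulrA -mpolyCM divfK//.
  by rewrite rmorphXn expf_neq0.
by apply: submoduleZ => //; apply: submodule_mx_ann.
Qed.
(** * Chains of primes *)

Section Ideals.
Variable S : comNzRingType.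
Implicit Types I P T : set S.

Definition ideal I := @submodule S S^o I.

Definition prime I := [/\ ideal I, ~ I 1 & forall a b, I (a * b) -> I a \/ I b].

Lemma ideal0 I : ideal I -> I 0. Proof. exact: submodule0. Qed.
Lemma idealMl I a b : ideal I -> I b -> I (a * b). Proof. exact: submoduleZ. Qed.
Lemma idealD I a b : ideal I -> I a -> I b -> I (a + b). Proof. exact: submoduleD. Qed.
Lemma ideal_sum I (J : Type) (r : seq J) (Q : pred J) F :
  ideal I -> (forall i, Q i -> I (F i)) -> I (\sum_(i <- r | Q i) F i).
Proof. exact: submodule_sum. Qed.

Lemma is_idealE I : is_ideal I <-> ideal I.
Proof.
split=> -[I0 IZ].
  by split=> [|a u v /mem_set Iu /mem_set Iv]; apply: set_mem => //; apply: IZ.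
by split=> [|a u v /set_mem Iu /set_mem Iv]; apply: mem_set => //; apply: IZ.
Qed.

Lemma is_prime_idealE P : is_prime_ideal P <-> prime P.
Proof.
split=> [[[P0 P1 PZ] PM]|[[P0 PZ] P1 PM]].
  split; first split; first exact: set_mem.
  - by move=> a u v /mem_set Pu /mem_set Pv; apply: set_mem; apply: PZ.
  - by move=> /mem_set; rewrite (negPf P1).
  - by move=> a b /mem_set/PM/orP[]/set_mem; [left|right].
split; last by move=> u v /set_mem/PM[]/mem_set->; rewrite ?orbT.
split; first exact: mem_set.
  by apply/negP => /set_mem.
by move=> a u v /set_mem Pu /set_mem Pv; apply: mem_set; apply: PZ.
Qed.

Definition ideal_adjoin I (y : S) : set S := [set a | exists p r, I p /\ a = p + r * y].

Lemma ideal_adjoinP I y : ideal I -> ideal (ideal_adjoin I y).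
Proof.
move=> II; split; first by exists 0, 0; rewrite mul0r addr0; split=> //; apply: ideal0.
move=> a _ _ [p [r [Ip ->]]] [q [t [Iq ->]]].
exists (a * p + q), (a * r + t); split; first by case: II => _; apply.
by rewrite /GRing.scale/=; ring.
Qed.

Lemma ideal_adjoin_sub I y : I `<=` ideal_adjoin I y.
Proof. by move=> a Ia; exists a, 0; rewrite mul0r addr0. Qed.

Lemma ideal_adjoin_mem I y : ideal I -> ideal_adjoin I y y.
Proof. by move=> II; exists 0, 1; rewrite mul1r add0r; split=> //; apply: ideal0. Qed.

(** An ideal above [I] that is maximal among those disjoint from the multiplicative set [T] is
    prime. *)
Lemma prime_avoiding I T : ideal I -> T 1 ->
  (forall a b, T a -> T b -> T (a * b)) -> (forall a, I a -> ~ T a) ->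
  exists P, [/\ prime P, I `<=` P & forall a, P a -> ~ T a].
Proof.
move=> II T1 TM IT.
pose Q (J : set S) := ideal J /\ (I `<=` J /\ forall a, J a -> ~ T a).
have [F FQ Ftot|A [[/= A0|[AI [IA AT]]] Amax]] :=
  @Zorn_bigcup S [set J | J = set0 \/ Q J].
- have [[J [FJ QJ]]|noJ] := pselect (exists J, F J /\ Q J); last first.
    left; rewrite -subset0 => x [J FJ Jx]; case: (FQ J FJ) => [J0|QJ]; last first.
      by case: noJ; exists J.
    by rewrite J0 in Jx.
  right; split; last split.
  + split; first by exists J => //; case: QJ => JI _; apply: ideal0.
    move=> a u v [X FX Xu] [Y FY Yv].
    have idl Z x : F Z -> Z x -> ideal Z.
      by move=> FZ Zx; case: (FQ Z FZ) => [Z0|[]//]; rewrite Z0 in Zx.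
    case: (Ftot X Y FX FY) => sub.
      by exists Y => //; case: (idl Y v FY Yv) => _; apply => //; apply: sub.
    by exists X => //; case: (idl X u FX Xu) => _; apply => //; apply: sub.
  + by move=> x Ix; exists J => //; case: QJ => _ [IJ _]; apply: IJ.
  + move=> x [X FX Xx]; case: (FQ X FX) => [X0|[_ [_]]]; last exact.
    by rewrite X0 in Xx.
- case: (Amax I); first by rewrite A0; split=> // /(_ 0); apply; apply: ideal0.
  by right; split=> //; split=> // x.
exists A; split=> //; split=> //; first by move=> /AT; apply.
move=> a b Aab; apply/or_asboolP/negPn/negP => /norP[/asboolPn nAa /asboolPn nAb].
(* By maximality [A + (y)] meets [T]. For [a] and [b] outside [A] with [a * b] in [A], the product
   of two such elements of [T] would lie in [A]. *)
have ext y : ~ A y -> exists p r, A p /\ T (p + r * y).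
  move=> nAy; have [//|nQ] := pselect (exists p r, A p /\ T (p + r * y)).
  case: (Amax (ideal_adjoin A y)); last first.
    right; split; first exact: ideal_adjoinP.
    split; first by move=> x /IA Ax; apply: ideal_adjoin_sub.
    by move=> x [p [r [Ap ->]]] Tx; apply: nQ; exists p, r.
  split; first exact: ideal_adjoin_sub.
  by move=> /(_ y (ideal_adjoin_mem y AI)).
have [p [r [Ap Tp]]] := ext a nAa; have [q [t [Aq Tq]]] := ext b nAb.
apply: (AT _ _ (TM _ _ Tp Tq)).
have -> : (p + r * a) * (q + t * b) = (q + t * b) * p + (r * a * q + (r * t) * (a * b)) by ring.
by apply: idealD => //; [exact: idealMl | apply: idealD => //; exact: idealMl].
Qed.

(* The ideals above [P_0] are required to contain a witness [y] of [P_0 < P_1]. *)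
Fixpoint chain (l : nat) I : Prop :=
  exists P, [/\ prime P, I `<=` P &
    if l is l'.+1 then exists2 y, ~ P y & chain l' (ideal_adjoin P y) else True].

(** A witness in [P_1] outside [P_0] lies in all later primes, so these contain [P_0 + (y)].
    Conversely, [y] makes the inclusion of [P_0] in each later prime strict. *)
Lemma has_prime_chainE l I : has_prime_chain I l <-> chain l I.
Proof.
elim: l I => [|l IH] I; split.
- move=> [P [HP _]]; exists (P ord0); have [/is_prime_idealE ? ?] := HP ord0.
  by split.
- move=> [P [/is_prime_idealE PP IP _]]; exists (fun=> P); split=> [i|i j]; first by split.
  by rewrite !ord1.
- move=> [P [HP Plt]]; exists (P ord0); have [/is_prime_idealE P0 IP0] := HP ord0.
  split=> //; have [P01 /existsNP[y /not_implyP[P1y P0y]]] := Plt ord0 (lift ord0 ord0) isT.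
  exists y => //; apply/IH; exists (fun i => P (lift ord0 i)); split=> [i|i j ij]; last first.
    exact: Plt.
  have [Pi IPi] := HP (lift ord0 i); split=> // x [p [r [Pp ->]]].
  have /is_prime_idealE[idPi _ _] := Pi.
  have sub1 : P (lift ord0 ord0) `<=` P (lift ord0 i).
    have [->|i0] := eqVneq i ord0; first by [].
    have lt0i : (@lift l.+2 ord0 ord0 < lift ord0 i)%N by rewrite /= /bump !add1n ltnS lt0n.
    by have [] := Plt _ _ lt0i.
  apply: idealD => //; first by have [+ _] := Plt ord0 (lift ord0 i) isT; apply.
  by apply: idealMl => //; apply: sub1.
move=> [P0 [PP IP [y P0y /IH[P [HP Plt]]]]].
exists (fun i => if unlift ord0 i is Some j then P j else P0); split=> [i|i j].
  case: unliftP => [j _|_]; last by split=> //; apply/is_prime_idealE.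
  have [Pj Hj] := HP j; split=> //; apply: subset_trans IP _; apply: subset_trans Hj.
  exact: ideal_adjoin_sub.
case: (unliftP ord0 i) => [i' ->|->]; case: (unliftP ord0 j) => [j' ->|->] //.
  by rewrite /= /bump !add1n ltnS; apply: Plt.
move=> _; have [Pj Hj] := HP j'; split.
  by apply: subset_trans Hj; apply: ideal_adjoin_sub.
move=> /(_ y (Hj y _)) /=; apply: contra_not P0y; apply.
by apply: ideal_adjoin_mem; case: PP.
Qed.

Lemma quotient_by_ideal I : ideal I -> ~ I 1 ->
  exists (Q : comNzRingType) (p : {rmorphism S -> Q}), forall a, p a = 0 <-> I a.
Proof.
move=> [I0 IZ] I1; pose X : {pred S} := fun x => x \in I.
have XP : idealr_closed X.
  split; first exact: mem_set; first by apply/negP => /set_mem.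
  by move=> a u v /set_mem Iu /set_mem Iv; apply: mem_set; apply: IZ.
pose m := isIdealr.Build S X XP.
pose XI : idealr S := HB.pack X m.
pose p : {rmorphism S -> {ideal_quot XI}} := \pi_{ideal_quot XI}.
have pE a : (p a == 0) = (a \in XI).
  by rewrite -(rmorph0 p) -[p a == p 0]/(a == 0 %[mod {ideal_quot XI}])
    -Quotient.idealrBE subr0.
exists {ideal_quot XI}, p => a; split=> [/eqP|Ia]; first by rewrite pE => /set_mem.
by apply/eqP; rewrite pE; apply: mem_set.
Qed.

End Ideals.
(** * Krull dimension from leading exponents *)

Section LeadingExponents.
Variables (F : fieldType) (n : nat).
Local Notation R := {mpoly F[n]}.
Implicit Types (I P : set R) (s t : seq R).

(** Linear independence over [F] modulo [I]. Coefficients belong to positions, so a repeated element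
    counts as a dependence. *)
Definition kfree I s := forall c : nat -> F,
  I (\sum_(0 <= i < size s) c i *: s`_i) -> forall i, (i < size s)%N -> c i = 0.

Lemma kfree_sub I P s : I `<=` P -> kfree P s -> kfree I s.
Proof. by move=> IP Ps c /IP; apply: Ps. Qed.

(** If [A + y * B] is in [P], then [A] is in [P + (y)], so its coefficients vanish. Hence [y * B] is
    in [P], and so is [B] because [P] is prime and [y] is outside it. *)
Lemma kfree_cat P y s t : prime P -> ~ P y ->
  kfree (ideal_adjoin P y) s -> kfree P t -> kfree P (s ++ [seq y * v | v <- t]).
Proof.
move=> [PI P1 PM] Py fs ft c; rewrite size_cat size_map.
pose A := \sum_(0 <= i < size s) c i *: s`_i.
pose B := \sum_(0 <= i < size t) c (i + size s)%N *: t`_i.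
have -> : \sum_(0 <= i < size s + size t) c i *: (s ++ [seq y * v | v <- t])`_i = A + y * B.
  rewrite (@big_cat_nat _ _ _ (size s))//= ?leq_addr//; congr (_ + _).
    by apply: eq_big_nat => i /andP[_ ilt]; rewrite nth_cat ilt.
  rewrite -{1}[size s]add0n big_addn addKn mulr_sumr; apply: eq_big_nat => i /andP[_ ilt].
  by rewrite nth_cat ltnNge leq_addl/= addnK (nth_map 0)// scalerAr.
move=> PAB; have cs : forall i, (i < size s)%N -> c i = 0.
  apply: fs; exists (A + y * B), (- B); split=> //.
  by rewrite mulNr [B * y]mulrC addrK.
have A0 : A = 0 by rewrite /A big_nat big1// => i /andP[_ /cs->]; rewrite scale0r.
have {}PAB : P B by move: PAB; rewrite A0 add0r => /PM[].
move=> i ilt; have [/cs//|le_si] := ltnP i (size s).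
rewrite -(subnK le_si); apply: (ft (fun i => c (i + size s)%N)) => //.
by rewrite ltn_subLR.
Qed.

(* The family consists of the products of the witnesses [y_i] of the chain with
   exponents below [N]. *)
Lemma chain_growth l I : chain l I -> exists D : nat, forall N : nat,
  exists s, [/\ size s = (N ^ l)%N, kfree I s & {in s, forall p, (msize p <= (D * N).+1)%N}].
Proof.
elim: l I => [|l IH] I [P [PP IP H]].
  exists 0%N => N; exists [:: 1]; split=> // [c|p]; last first.
    by rewrite inE => /eqP->; rewrite msize1.
  rewrite /= big_nat1/= => /IP Pc [|//] _; have [PI P1 _] := PP.
  have [//|c0] := eqVneq (c 0%N) 0; case: P1.
  have -> : 1 = ((c 0%N)^-1)%:MP * (c 0%N *: 1) :> R.
    by rewrite mul_mpolyC scalerA mulVf// scale1r.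
  exact: idealMl.
have [y Py /IH[D HD]] := H; exists (D + (msize y).+1)%N => N.
have [t [St ft mt]] := HD N.
(* The family for [i.+1] is [t] followed by [y] times the family for [i]; [kfree_cat] applies
   because [t] is independent even modulo [P + (y)]. *)
suff /(_ N)[s [Ss fs ms]] i : exists s, [/\ size s = (i * N ^ l)%N, kfree P s &
    {in s, forall p, (msize p <= (D * N + i * (msize y).+1).+1)%N}].
  exists s; split; rewrite ?expnS//; first exact: kfree_sub fs.
  by move=> p /ms; rewrite mulnDl [((msize y).+1 * N)%N]mulnC.
elim: i => [|i [s [Ss fs ms]]].
  by exists [::]; split.
exists (t ++ [seq y * v | v <- s]); split; first by rewrite size_cat size_map Ss St mulSn.
- exact: kfree_cat.
move=> p; rewrite mem_cat => /orP[/mt|/mapP[v /ms mv ->]].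
  by move/leq_trans; apply; rewrite ltnS leq_addr.
apply: leq_trans (msizeM_le _ _) _.
by rewrite ltnS mulSn addSn addnS addnCA -addnS leq_add2l.
Qed.

Definition mon I := lead_exps id I.

(** A leading monomial in [mon I] is cancelled by an element of [I], any other one is moved to the
    remainder. The monomial order refines the degree, so the size bound persists. *)
Lemma reduce_mod I k p : ideal I -> (msize p <= k)%N -> exists a : R,
  [/\ {in msupp a, forall m, ~ mon I m}, (msize a <= k)%N & I (p - a)].
Proof.
move=> II; have [m Hm] : {m | mlead p = m} by exists (mlead p).
elim/(@ltmwf n): m p Hm => m IH p Hm pk.
have [->|p0] := eqVneq p 0.
  exists 0; split; rewrite ?subr0 ?msize0//; last exact: ideal0.
  by move=> x; rewrite msupp0.
have [q [q0 qm Hq]] : exists q, [/\ q != 0, mlead q = m & I q \/ q = 'X_[m] /\ ~ mon I m].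
  have [[q [Iq q0 qm]]|nE] := pselect (mon I m); first by exists q; split=> //; left.
  by exists 'X_[m]; rewrite mleadXm -msupp_eq0 msuppX; split=> //; right.
pose c := p@_m / q@_m.
have qmn0 : q@_m != 0 by rewrite -qm mleadc_eq0.
have km : (mdeg m < k)%N by rewrite -Hm mlead_deg.
have [a' [aE ak Ia]] : exists a : R,
    [/\ {in msupp a, forall m, ~ mon I m}, (msize a <= k)%N & I (p - c *: q - a)].
  have [->|p'0] := eqVneq (p - c *: q) 0.
    exists 0; split; rewrite ?subr0 ?msize0//; last exact: ideal0.
    by move=> x; rewrite msupp0.
  apply: (IH (mlead (p - c *: q))) => //.
    rewrite lt_neqAle; apply/andP; split.
      apply: contraNneq p'0 => E; rewrite -mleadc_eq0 E mcoeffB mcoeffZ.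
      by rewrite /c divfK ?subrr.
    apply: le_trans (mleadB_le _ _) _; rewrite Hm leUx lexx/=.
    by apply: le_trans (mleadZ_le _ _) _; rewrite qm.
  rewrite -mlead_deg//; apply: leq_ltn_trans km; apply: lemc_mdeg.
  apply: le_trans (mleadB_le _ _) _; rewrite Hm leUx lexx/=.
  by apply: le_trans (mleadZ_le _ _) _; rewrite qm.
case: Hq => [Iq|[qX nE]].
  exists a'; split=> //.
  have -> : p - a' = (p - c *: q - a') + c%:MP * q by rewrite mul_mpolyC; ring.
  by apply: idealD => //; apply: idealMl.
exists (a' + c *: q); split.
- move=> x /msuppD_le; rewrite mem_cat => /orP[/aE//|/msuppZ_le].
  by rewrite qX => /mem_msuppXP <-.
- apply: leq_trans (msizeD_le _ _) _; rewrite geq_max ak/=.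
  by apply: leq_trans (msizeZ_le _ _) _; rewrite qX msizeX.
- by rewrite opprD addrA addrAC.
Qed.

Definition std I k : {set 'X_{1..n < k}} := [set m : 'X_{1..n < k} | ~~ `[< mon I m >] ]%SET.

(** Modulo [I], the elements of [s] become combinations of standard monomials of degree below [k].
    If [s] were longer than the list of these monomials, the coefficient matrix [C] would have a
    nonzero left kernel, which is a relation modulo [I]. *)
Lemma kfree_size I s k : ideal I -> kfree I s ->
  {in s, forall p, (msize p <= k)%N} -> (size s <= #|std I k|)%N.
Proof.
move=> II fs ms; rewrite leqNgt; apply/negP => lt_s.
have /choice[a Ha] (i : 'I_(size s)) := reduce_mod II (ms _ (mem_nth 0 (ltn_ord i))).
pose C := \matrix_(i < size s, j < #|std I k|) (a i)@_(enum_val j).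
have : kermx C != 0.
  rewrite kermx_eq0 /row_free; apply: contraTneq lt_s => <-.
  by rewrite -leqNgt rank_leq_col.
case/rowV0Pn=> v /sub_kermxP vC v0.
have Ev : \sum_i v 0 i *: a i = 0.
  apply/mpolyP => m; rewrite raddf_sum mcoeff0/=.
  have [mk|km] := ltnP (mdeg m) k; last first.
    rewrite big1// => i _; rewrite mcoeffZ memN_msupp_eq0 ?mulr0//.
    apply/negP => /msize_mdeg_lt; rewrite ltnNge => /negP; apply.
    by have [_ ak _] := Ha i; apply: leq_trans ak km.
  pose m' : 'X_{1..n < k} := BMultinom mk.
  have [mS|mS] := boolP (m' \in std I k).
    have /(congr1 (fun B : 'rV_ _ => B 0 (enum_rank_in mS m'))) := vC.
    rewrite !mxE => E; rewrite -[RHS]E; apply: eq_bigr => i _.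
    by rewrite mxE enum_rankK_in// mcoeffZ.
  rewrite big1// => i _; rewrite mcoeffZ memN_msupp_eq0 ?mulr0//.
  apply/negP => mi; have [/(_ m mi) nE _ _] := Ha i.
  by move: mS; rewrite inE negbK => /asboolP.
have vE : forall i : 'I_(size s), v 0 i = 0.
  pose c i := if insub i is Some j then v 0 j else 0.
  have cE (i : 'I_(size s)) : c i = v 0 i by rewrite /c valK.
  move=> i; rewrite -cE; apply: fs => //.
  rewrite big_mkord; under eq_bigr do rewrite cE.
  have <- : \sum_i v 0 i *: (s`_i - a i) = \sum_i v 0 i *: s`_i.
    by under eq_bigr do rewrite scalerBr; rewrite sumrB Ev subr0.
  apply: ideal_sum => // j _.
  by rewrite -mul_mpolyC; apply: idealMl => //; have [] := Ha j.
by case/eqP: v0; apply/rowP => i; rewrite vE mxE.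
Qed.

Definition supported (Y : {set 'I_n}) (m : 'X_{1..n}) := forall i, i \notin Y -> m i = 0%N.

Lemma mon_up I m m' : ideal I -> mon I m -> (m <= m')%MM -> mon I m'.
Proof.
move=> II [p [Ip p0 <-]] le_m; exists ('X_[m' - mlead p] * p); split.
- exact: idealMl.
- by rewrite mulf_neq0// -msupp_eq0 msuppX.
- by rewrite mleadM ?mleadXm ?submK// -msupp_eq0 msuppX.
Qed.

(* Let [b] bound the exponents of the given elements of [mon I]. A standard monomial
   has at most [l] exponents [>= b], so it is determined by their positions, their
   values, and the other exponents. *)
Lemma std_card_le I l : ideal I ->
  (forall Y : {set 'I_n}, #|Y| = l.+1 -> exists2 m, mon I m & supported Y m) ->
  exists C : nat, forall k, (#|std I k| <= C * k ^ l)%N.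
Proof.
move=> II H.
have /choice[e He] (Y : {set 'I_n}) : exists m, #|Y| = l.+1 -> mon I m /\ supported Y m.
  by have [/H[m ? ?]|nl] := pselect (#|Y| = l.+1); [exists m | exists 0%MM].
pose b := \max_(Y : {set 'I_n}) \max_i e Y i.
have be Y i : (e Y i <= b)%N.
  by apply: leq_trans (leq_bigmax Y); apply: (leq_bigmax (F := fun i => e Y i)).
pose big (m : 'X_{1..n}) : {set 'I_n} := [set i | (b <= m i)%N]%SET.
have big_small k (m : 'X_{1..n < k}) : m \in std I k -> (#|big m| <= l)%N.
  rewrite inE => /asboolPn nE; rewrite leqNgt; apply/negP => lt_l.
  have [Y /andP[Ysub /eqP Yl]] : exists Y : {set 'I_n}, (Y \subset big m) && (#|Y| == l.+1).
    exists [set x in take l.+1 (enum (big m))]%SET; apply/andP; split.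
      by apply/fintype.subsetP => x; rewrite inE => /mem_take; rewrite mem_enum.
    rewrite cardsE; apply/eqP; rewrite (card_uniqP _) ?take_uniq ?enum_uniq//.
    by rewrite size_takel// -cardE.
  have [Ee se] := He Y Yl; apply: nE; apply: mon_up Ee _ => //.
  apply/mnm_lepP => i; have [iY|/se->//] := boolP (i \in Y).
  by apply: leq_trans (be Y i) _; have := fintype.subsetP Ysub i iY; rewrite inE.
(* The constant counts the sets of large positions and the exponents capped at [b]; the factor
   [k ^ l] counts the values at the large positions. *)
exists #|{: {set 'I_n} * {ffun 'I_n -> 'I_b.+1}}| => k.
pose T := (({set 'I_n} * {ffun 'I_n -> 'I_b.+1}) * {ffun 'I_l -> 'I_k})%type.
(* The use of [inord] requires a nonempty range; for [k = 0] there are no monomials at all. *)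
case: k => [|k] in T *.
  rewrite (_ : std I 0 = finset.set0) ?cards0//; apply/setP => m; rewrite !inE.
  by have := bmdeg m; rewrite ltn0.
(* At a small position the capped exponent is the true one. The values at the large positions are
   listed in the order of [enum] and padded to length [l]. *)
pose f (m : 'X_{1..n < k.+1}) : T :=
  ((big m, [ffun i => inord (minn (m i) b)]),
   [ffun j : 'I_l => inord (nth 0%N [seq m i | i <- enum (big m)] j)]).
have finj : {in std I k.+1 &, injective f}.
  move=> m1 m2 /big_small b1 /big_small b2 [Eb /ffunP Es /ffunP Et].
  have mk (m : 'X_{1..n < k.+1}) i : (m i < k.+1)%N.
    by apply: leq_ltn_trans (bmdeg m); rewrite mdegE (bigD1 i)//= leq_addr.
  apply/val_inj/mnmP => i /=; have [ib|ib] := boolP (i \in big m1); last first.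
    have ib2 : i \notin big m2 by rewrite -Eb.
    move: ib ib2; rewrite !inE -!ltnNge => /ltnW lt1 /ltnW lt2.
    have := Es i; rewrite !ffunE => /(congr1 val); rewrite /= !inordK ?ltnS ?geq_minr//.
    by rewrite !(minn_idPl _).
  pose j := index i (enum (big m1)).
  have jlt : (j < size (enum (big m1)))%N by rewrite index_mem mem_enum.
  have jl : (j < l)%N by apply: leq_trans b1; rewrite cardE.
  have := Et (Ordinal jl); rewrite !ffunE/= -Eb.
  rewrite !(nth_map i) // nth_index ?mem_enum// => /(congr1 val).
  by rewrite /= !inordK.
rewrite -(card_in_imset finj) (leq_trans (max_card _))// card_prod.
by rewrite card_ffun !card_ord.
Qed.

(** If every set of [l] variables supported an exponent of [mon I], the standard monomials would
    grow with order at most [l - 1], against the [N ^ l] independent elements of degree linear in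
    [N] that the chain provides. *)
Theorem chain_free_variables l I : ideal I -> chain l I ->
  exists2 Y : {set 'I_n}, #|Y| = l & forall m, mon I m -> ~ supported Y m.
Proof.
move=> II cl; have [//|noY] := pselect (exists2 Y : {set 'I_n}, #|Y| = l &
  forall m, mon I m -> ~ supported Y m).
have H (Y : {set 'I_n}) : #|Y| = l -> exists2 m, mon I m & supported Y m.
  move=> Yl; have [//|noM] := pselect (exists2 m, mon I m & supported Y m).
  by case: noY; exists Y => // m Em sm; apply: noM; exists m.
(* For [l = 0] the empty set supports only the zero exponent, so [I] would contain a nonzero
   constant. *)
case: l => [|l] in cl H noY *.
  have [m [p [Ip p0 pm]] m0] := H finset.set0 (cards0 _).
  have [P [[PI P1 _] /(_ _ Ip) Pp _]] := cl; case: P1.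
  have m00 : m = 0%MM by apply/mnmP => i; rewrite m0 ?inE// mnm0E.
  have pC : p = (p@_0)%:MP.
    by apply: msize1_polyC; rewrite -mlead_deg// pm m00 mdeg0.
  have p00 : p@_0 != 0 by rewrite -m00 -pm mleadc_eq0.
  rewrite -(mpolyC1 n F) -(mulVf p00) mpolyCM -pC; exact: idealMl.
have [C HC] := std_card_le II H; have [D HD] := chain_growth cl.
(* Here the chain has length [l.+1]. Since [N > C (D+1)^l], the power [N^(l+1)] exceeds
   [C ((D+1) N)^l], which is at least [C (D N + 1)^l]. *)
pose N := (C * D.+1 ^ l).+1.
have [s [Ss fs ms]] := HD N.
have := leq_trans (kfree_size II fs ms) (HC _); rewrite Ss.
move=> le_sC; exfalso; move: le_sC; apply/negP; rewrite -ltnNge.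
have le1 : ((D * N).+1 ^ l <= (D.+1 * N) ^ l)%N.
  by case: (l) => [|l']; rewrite ?expn0// leq_exp2r// mulSn addnC -addn1 leq_add2l.
apply: leq_ltn_trans (leq_mul (leqnn C) le1) _.
by rewrite expnMn mulnA expnS ltn_pmul2r ?expn_gt0.
Qed.

End LeadingExponents.

(** * Chains of primes from independent variables *)

Section Variables.
Variables (F : fieldType) (n : nat).
Local Notation R := {mpoly F[n]}.
Implicit Types (I P : set R) (p q : R) (Y : {set 'I_n}).

(** The retraction of [F[x]] onto [F[Y]], whose fixed points are the elements of [F[Y]]. Being a
    ring morphism, it can be composed with [pi] to state integrality over the image of [F[Y]] by
    [integralOver]. *)
Definition keep Y : R -> R := comp_mpoly [tuple (if i \in Y then 'X_i else 0 : R) | i < n].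

HB.instance Definition _ Y := GRing.RMorphism.copy (keep Y)
  (comp_mpoly [tuple (if i \in Y then 'X_i else 0 : R) | i < n]).

Definition supportedb Y (m : 'X_{1..n}) := [forall i, (i \notin Y) ==> (m i == 0%N)].

Lemma supportedP Y m : reflect (supported Y m) (supportedb Y m).
Proof.
apply: (iffP forallP) => H i; first by move=> iY; have := H i; rewrite iY => /eqP.
by apply/implyP => /H ->.
Qed.

Lemma keepX Y m : keep Y 'X_[m] = if supportedb Y m then 'X_[m] else 0.
Proof.
rewrite /keep comp_mpolyX; case: ifPn => [/supportedP sm|].
  rewrite mpolyXE_id; apply: eq_bigr => i _; rewrite tnth_mktuple.
  by case: ifPn => // /sm->.
rewrite negb_forall => /existsP[i]; rewrite negb_imply => /andP[iY mi].
by rewrite (bigD1 i)//= tnth_mktuple (negPf iY) expr0n (negPf mi) mul0r.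
Qed.

Lemma keepZ Y c p : keep Y (c *: p) = c *: keep Y p.
Proof. exact: comp_mpolyZ. Qed.

Lemma mcoeff_keep Y p m : (keep Y p)@_m = if supportedb Y m then p@_m else 0.
Proof.
have E : p@_m = \sum_(x <- msupp p) (p@_x *: 'X_[x])@_m.
  by rewrite {1}[p]mpolyE (raddf_sum (mcoeff m)).
rewrite {}E {1}[p]mpolyE (raddf_sum (keep Y)) (raddf_sum (mcoeff m)).
rewrite (_ : (if _ then _ else _) =
    \sum_(x <- msupp p) if supportedb Y m then (p@_x *: 'X_[x])@_m else 0); last first.
  by case: ifP => // _; rewrite big1.
apply: eq_bigr => x _; rewrite /= keepZ keepX.
have [->|xm] := eqVneq x m; first by case: ifP; rewrite // scaler0 mcoeff0.
by case: ifP => _; case: ifP => _; rewrite ?scaler0 ?mcoeff0// mcoeffZ mcoeffX (negPf xm) mulr0.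
Qed.

Definition polyin Y p := keep Y p = p.

Lemma polyinP Y p : polyin Y p <-> {in msupp p, forall m, supported Y m}.
Proof.
split=> [pY m|H].
  by rewrite -pY mcoeff_msupp mcoeff_keep; case: supportedP => //; rewrite eqxx.
apply/mpolyP => m; rewrite mcoeff_keep; case: supportedP => // nm.
by rewrite memN_msupp_eq0//; apply/negP => /H.
Qed.

Lemma keep_polyin Y p : polyin Y (keep Y p).
Proof.
by apply/mpolyP => m; rewrite !mcoeff_keep; case: (supportedb Y m).
Qed.

Lemma polyinM Y p q : polyin Y p -> polyin Y q -> polyin Y (p * q).
Proof. by move=> pY qY; rewrite /polyin (rmorphM (keep Y))/= pY qY. Qed.
Lemma polyinD Y p q : polyin Y p -> polyin Y q -> polyin Y (p + q).
Proof. by move=> pY qY; rewrite /polyin (rmorphD (keep Y))/= pY qY. Qed.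
Lemma polyinXn Y p k : polyin Y p -> polyin Y (p ^+ k).
Proof. by move=> pY; rewrite /polyin (rmorphXn (keep Y))/= pY. Qed.
Lemma polyin1 Y : polyin Y 1. Proof. exact: (rmorph1 (keep Y)). Qed.
Lemma polyin0 Y : polyin Y 0. Proof. exact: (rmorph0 (keep Y)). Qed.
Lemma polyin_sum Y (J : Type) (r : seq J) (Q : pred J) G :
  (forall i, Q i -> polyin Y (G i)) -> polyin Y (\sum_(i <- r | Q i) G i).
Proof. by move=> H; rewrite /polyin (rmorph_sum (keep Y)); apply: eq_bigr. Qed.
Lemma polyin_prod Y (J : Type) (r : seq J) (Q : pred J) G :
  (forall i, Q i -> polyin Y (G i)) -> polyin Y (\prod_(i <- r | Q i) G i).
Proof. by move=> H; rewrite /polyin (rmorph_prod (keep Y)); apply: eq_bigr. Qed.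

Lemma polyinX Y i : i \in Y -> polyin Y 'X_i.
Proof.
move=> iY; apply/polyinP => m /mem_msuppXP <- j; rewrite mnm1E => jY.
by case: eqP jY => // <-; rewrite iY.
Qed.

Lemma polyin_sub Y (Z : {set 'I_n}) p : Y \subset Z -> polyin Y p -> polyin Z p.
Proof.
move=> YZ /polyinP H; apply/polyinP => m /H sm i iZ; apply: sm.
by apply: contra iZ; apply: fintype.subsetP.
Qed.

Lemma mlead_polyin Y p i : polyin Y p -> i \notin Y -> mlead p i = 0%N.
Proof.
have [->|p0] := eqVneq p 0; first by rewrite mlead0 mnm0E.
by move=> /polyinP/(_ _ (mlead_supp p0)); apply.
Qed.

Lemma polyin_setU1 Y j p : j \notin Y -> polyin (j |: Y) p ->
  exists2 G : {poly R}, forall i, polyin Y G`_i & G.['X_j] = p.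
Proof.
move=> jY /polyinP pY; pose mj (m : 'X_{1..n}) := (m - U_(j) *+ m j)%MM.
exists (\sum_(m <- msupp p) (p@_m *: 'X_[mj m])%:P * 'X^(m j)) => [i|].
  rewrite coef_sum big_seq; apply: polyin_sum => m mp; rewrite coefMXn coefC.
  case: ifP => _; first exact: polyin0.
  case: ifP => _; last exact: polyin0.
  apply/polyinP => m' /msuppZ_le/mem_msuppXP <- i' i'Y; rewrite /mj mnmBE mulmnE mnm1E.
  have [<-|ij] := eqVneq j i'; first by rewrite mul1n subnn.
  by rewrite subn0; apply: (pY m mp); rewrite in_setU1 eq_sym (negPf ij).
rewrite horner_sum [RHS]mpolyE; apply: eq_bigr => m _.
rewrite hornerM hornerC hornerXn mpolyXn -scalerAl -mpolyXD submK//.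
apply/mnm_lepP => i; rewrite mulmnE mnm1E; case: eqP => [<-|]; rewrite ?mul1n//.
Qed.

(** Algebraic independence of the variables in [Y] modulo [I]. *)
Definition indep I Y := forall p, polyin Y p -> I p -> p = 0.

Section IntegralElements.
Variables (P : set R) (Y : {set 'I_n}) (Q : comNzRingType) (pi : {rmorphism R -> Q}).
Hypotheses (piP : forall a, pi a = 0 <-> P a) (indepY : indep P Y).

Local Notation sigma := (pi \o keep Y).

Lemma polyin_integral p : polyin Y p -> integralOver sigma (pi p).
Proof. by move=> pY; have := integral_id sigma p; rewrite /= pY. Qed.

(** A relation [p] in [P] is a polynomial in [X_j] over [F[Y]] with some leading coefficient [c];
    multiplied by a power of [c], it becomes monic in [c * X_j]. *)
Lemma variable_integral j : ~ indep P (j |: Y) -> exists c,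
  [/\ polyin Y c, c != 0 & integralOver sigma (pi (c * 'X_j))].
Proof.
move=> /existsNP[p /not_implyP[pjY /not_implyP[Pp p0]]].
have [jY|jY] := boolP (j \in Y).
  have jYE : j |: Y = Y by apply/finset.setUidPr; rewrite finset.sub1set.
  by move: pjY; rewrite jYE => /indepY/(_ Pp).
have [G GY Gp] := polyin_setU1 jY pjY.
have G0 : G != 0 by apply: contra_not_neq p0 => G0; rewrite -Gp G0 horner0.
exists (lead_coef G); split; rewrite ?lead_coef_eq0//; first exact: GY.
set c := lead_coef G; pose e := (size G).-1.
have sG : size G = e.+1 by rewrite /e prednK// size_poly_gt0.
have e0 : (0 < e)%N.
  rewrite lt0n; apply: contra_not_neq p0 => e0; apply: indepY => //.
  by rewrite -Gp (size1_polyC (_ : size G <= 1)%N) ?hornerC; [exact: GY|rewrite sG e0].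
(* [M] is [c^(e-1) G(X / c)], so that [M.[c X_j] = c^(e-1) p]. *)
pose M := \poly_(i < e.+1) (if i == e then 1 else G`_i * c ^+ (e.-1 - i)).
have MY i : polyin Y M`_i.
  rewrite coef_poly; case: ifP => _; last exact: polyin0.
  case: ifP => _; first exact: polyin1.
  by apply: polyinM => //; apply: polyinXn; apply: GY.
have Mmonic : M \is monic.
  by rewrite monicE lead_coef_poly// ?eqxx ?oner_eq0.
have ME : M.[c * 'X_j] = c ^+ e.-1 * p.
  rewrite -Gp !horner_coef sG mulr_sumr (size_poly_eq _) ?eqxx ?oner_eq0//.
  apply: eq_bigr => i _; rewrite coef_poly ltn_ord exprMn.
  case: eqP => [->|ie].
    have -> : G`_e = c by rewrite /c lead_coefE.
    by rewrite mul1r -{1}(prednK e0) exprS; ring.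
  have ile : (i <= e.-1)%N by rewrite -ltnS prednK// ltn_neqAle -ltnS ltn_ord andbT; apply/eqP.
  by rewrite -{2}(subnK ile) exprD; ring.
apply: (@integral_root_monic _ _ sigma _ (map_poly pi M)).
- exact: monic_map.
- by rewrite rootE horner_map/= ME rmorphM/= (piP p).2// mulr0.
- by apply/integral_poly => i; rewrite coef_map; apply: polyin_integral.
Qed.

(** When [Y] is maximal, each variable becomes integral after multiplication by some [cj]. The
    elements made integral by a power of the product [c] are closed under sums and products, and
    include the constants and all variables. *)
Lemma integral_denominator : (forall j, j \notin Y -> ~ indep P (j |: Y)) ->
  exists c, [/\ polyin Y c, c != 0 &
    forall r, exists N, integralOver sigma (pi (c ^+ N * r))].
Proof.
move=> maxY; have /choice[cj Hcj] j : exists c,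
    [/\ polyin Y c, c != 0 & integralOver sigma (pi (c * 'X_j))].
  have [jY|/maxY] := boolP (j \in Y); last exact: variable_integral.
  exists 1; rewrite mul1r oner_eq0; split=> //; first exact: polyin1.
  by apply: polyin_integral; apply: polyinX.
pose c := \prod_j cj j; have cY : polyin Y c by apply: polyin_prod => j _; case: (Hcj j).
exists c; split=> //.
  by rewrite prodf_seq_neq0; apply/allP => j _; case: (Hcj j).
have cint k : integralOver sigma (pi (c ^+ k)) by apply: polyin_integral; apply: polyinXn.
pose G r := exists N, integralOver sigma (pi (c ^+ N * r)).
have GM a b : G a -> G b -> G (a * b).
  move=> [N Na] [N' Nb]; exists (N + N')%N; rewrite exprD mulrACA rmorphM.
  exact: integral_mul.
have GD a b : G a -> G b -> G (a + b).
  move=> [N Na] [N' Nb]; exists (N + N')%N.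
  have -> : c ^+ (N + N') * (a + b) = c ^+ N' * (c ^+ N * a) + c ^+ N * (c ^+ N' * b).
    by rewrite exprD; ring.
  by rewrite rmorphD !rmorphM; apply: integral_add; rewrite -!rmorphM rmorphM;
    apply: integral_mul.
have GY a : polyin Y a -> G a.
  by move=> aY; exists 0%N; rewrite mul1r; apply: polyin_integral.
have GX j : G 'X_j.
  exists 1%N; rewrite expr1 /c (bigD1 j)//= mulrAC mulrC rmorphM.
  apply: integral_mul; last by case: (Hcj j).
  by apply: polyin_integral; apply: polyin_prod => i _; case: (Hcj i).
have GC a : G a%:MP by apply: GY; rewrite /polyin /keep comp_mpolyC.
move=> r; rewrite -/(G r) [r]mpolyE; elim/big_ind: _ => //.
  by rewrite -(mpolyC0 n F).
move=> m _; rewrite -mul_mpolyC; apply: (GM) => //.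
rewrite mpolyXE_id; elim/big_ind: _ => //; first exact: (GC 1).
move=> i _; elim: (m i) => [|k IH]; first exact: (GC 1).
by rewrite exprS; apply: (GM).
Qed.

End IntegralElements.

(* Take [q = 1 + X_y c]. If [f = q r] mod [P], then [c^N r] is integral over [F[Y]],
   so [q] divides a power of [c^N f] in [F[Y]], hence one of [f] since [c] is a unit
   mod [q]; but [X_y] divides the leading monomial of [q]. *)
Lemma indep_cut P Y y : prime P -> indep P Y ->
  (forall j, j \notin Y -> ~ indep P (j |: Y)) -> y \in Y ->
  exists2 q, ~ P q & indep (ideal_adjoin P q) (Y :\ y).
Proof.
move=> [PI P1 PM] indepY maxY yY.
have [Q [pi piP]] := quotient_by_ideal PI P1.
have [c [cY c0 Hc]] := integral_denominator piP indepY maxY.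
pose z := 'X_y * c; have z0 : z != 0 by rewrite mulf_neq0// -msupp_eq0 msuppX.
pose q := 1 + z.
have leadz : mlead z = (U_(y) + mlead c)%MM by rewrite mleadM ?mleadXm// -msupp_eq0 msuppX.
have leadq : mlead q = mlead z.
  rewrite /q mleadDr// mlead1; apply: lt_mdeg_ltmc.
  by rewrite mdeg0 leadz mdegD mdeg1.
have leady : (0 < mlead q y)%N by rewrite leadq leadz mnmDE mnm1E eqxx.
have q0 : q != 0 by apply: contraTneq leady => ->; rewrite mlead0 mnm0E.
have qY : polyin Y q.
  by apply: polyinD; [exact: polyin1 | apply: polyinM => //; exact: polyinX].
exists q; first by move=> /(indepY _ qY)/eqP; rewrite (negPf q0).
move=> f fYy [p0 [r [Pp0 Ef]]].
have fY : polyin Y f by apply: polyin_sub fYy; apply: subsetDl.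
have [N [g gm groot]] := Hc r.
pose e := (size g).-1.
have sg : size g = e.+1 by rewrite /e prednK// size_poly_gt0 monic_neq0.
(* This is the monic equation [g] of [c ^+ N * r], homogenized by powers of [q]. Modulo [P], where
   [f = q * r], it equals [q ^+ e] times that equation; its terms lie in [F[Y]], so independence
   forces [Z = 0]. *)
pose Z := \sum_(i < e.+1) keep Y g`_i * q ^+ (e - i) * (c ^+ N * f) ^+ i.
have ZY : polyin Y Z.
  apply: polyin_sum => i _; apply: polyinM; last first.
    by apply: polyinXn; apply: polyinM => //; apply: polyinXn.
  by apply: polyinM; [exact: keep_polyin | exact: polyinXn].
have PZ : P Z.
  apply/piP; move: groot; rewrite rootE horner_coef size_map_poly_id0; last first.
    by rewrite (monicP gm) rmorph1 oner_eq0.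
  rewrite sg => /eqP E.
  have pif : pi f = pi r * pi q by rewrite Ef rmorphD (piP p0).2// add0r rmorphM.
  rewrite -[RHS](mulr0 (pi q ^+ e)) -E mulr_sumr rmorph_sum; apply: eq_bigr => i _.
  have ie : (i <= e)%N by rewrite -ltnS.
  rewrite coef_map/= !(rmorphM pi, rmorphXn pi)/= pif !exprMn.
  have -> : pi q ^+ e = pi q ^+ (e - i) * pi q ^+ i by rewrite -exprD subnK.
  by ring.
have {}PZ : Z = 0 by apply: indepY.
have [//|f0] := eqVneq f 0; exfalso.
(* Every term of [Z] except the top one contains a factor [q]. *)
have [h Hh] : exists h, (c ^+ N * f) ^+ e = q * h.
  exists (- \sum_(i < e) keep Y g`_i * q ^+ (e - i.+1) * (c ^+ N * f) ^+ i).
  have ge : g`_e = 1 by have := monicP gm; rewrite lead_coefE.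
  move: PZ; rewrite /Z big_ord_recr/= ge (rmorph1 (keep Y)) subnn expr0 !mul1r addrC.
  move/eqP; rewrite addr_eq0 => /eqP->; rewrite mulrN mulr_sumr; congr (- _).
  apply: eq_bigr => i _.
  have -> : q ^+ (e - i) = q * q ^+ (e - i.+1) by rewrite -exprS -subSn ?subSS.
  by ring.
(* As [z = q - 1] is invertible modulo [q], its powers can be cancelled. *)
have Hdvd M u : (exists h, z ^+ M * u = q * h) -> exists h, u = q * h.
  elim: M => [|M IH]; first by rewrite expr0 mul1r.
  move=> [h1 E]; apply: IH; exists (z ^+ M * u - h1).
  by rewrite mulrBr -E /q exprS; ring.
have [h1 Hh1] : exists h, f ^+ e = q * h.
  apply: (Hdvd (N * e)%N); exists ('X_y ^+ (N * e) * h).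
  by rewrite mulrCA -Hh /z !exprMn -exprM; ring.
have h10 : h1 != 0.
  by apply: contraTneq (expf_neq0 e f0) => h10; rewrite Hh1 h10 mulr0 eqxx.
have /(congr1 (fun m : 'X_{1..n} => m y)) := congr1 (@mlead _ _) Hh1.
rewrite mleadX// mleadM// mulmnE (mlead_polyin fYy) ?setD11// mnmDE mul0n => /eqP.
by rewrite eq_sym addn_eq0 eqn0Ngt leady.
Qed.

(** The bound on [#|Y|] is an inequality because [Y] is enlarged to a set [Z] that is maximal
    independent modulo [P]. The cut by [q] removes one variable from [Z], so [P] with witness [q]
    starts the chain and induction continues above [P + (q)]. *)
Theorem indep_chain l I Y : ideal I -> (l <= #|Y|)%N -> indep I Y -> chain l I.
Proof.
elim: l I Y => [|l IH] I Y II lY IY.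
(* In both cases [P] is a prime avoiding the multiplicative set of nonzero elements of [F[Y]]. *)
all: have [P [PP IP PT]] : exists P, [/\ prime P, I `<=` P &
    forall a, P a -> ~ (polyin Y a /\ a != 0)].
1,3: apply: prime_avoiding => //; [by split; [exact: polyin1|exact: oner_neq0]
  | by move=> a b [aY a0] [bY b0]; split; [exact: polyinM|exact: mulf_neq0]
  | by move=> a Ia [aY /eqP a0]; apply: a0; apply: IY].
  by exists P; split.
have indepY : indep P Y.
  by move=> p pY Pp; apply/eqP/negPn/negP => p0; apply: (PT p).
have [Z /maxsetP[/asboolP indepZ maxZ] YZ] :=
  maxset_exists (P := fun Z => `[< indep P Z >]) (asboolT indepY).
have lZ : (l < #|Z|)%N by apply: leq_trans lY _; apply: subset_leq_card.
have [y yZ] : exists y, y \in Z by apply/card_gt0P; apply: leq_ltn_trans lZ.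
have [|q Pq indepq] := indep_cut PP indepZ _ yZ.
  move=> j jZ /asboolT/maxZ; rewrite finset.subsetUr => /(_ isT) E.
  by move: jZ; rewrite -E setU11.
exists P; split=> //; exists q => //; apply: IH indepq.
  by apply: ideal_adjoinP; case: PP.
by move: lZ; rewrite (cardsD1 y) yZ.
Qed.

(** For the converse, the leading exponent of a nonzero element of [F[Y]] is supported by [Y], so
    [Y] is independent modulo [I]. *)
Corollary chainE l I : ideal I -> chain l I <->
  exists2 Y : {set 'I_n}, #|Y| = l & forall m, mon I m -> ~ supported Y m.
Proof.
move=> II; split; first exact: chain_free_variables.
move=> [Y Yl H]; apply: (@indep_chain _ _ Y); rewrite ?Yl// => p pY Ip.
apply/eqP/negPn/negP => p0; apply: (H (mlead p)); first by exists p.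
by move=> i; apply: mlead_polyin.
Qed.

End Variables.
(** * Specialization *)

Section NonRoot.
Variables (F : fieldType) (n : nat).
Hypothesis F_infinite : forall N, exists2 r : seq F, uniq r & (N <= size r)%N.

Lemma meval_polyin (Y : {set 'I_n}) (p : {mpoly F[n]}) v v' :
  polyin Y p -> {in Y, forall i, v i = v' i} -> p.@[v] = p.@[v'].
Proof.
move=> /polyinP pY vv'; rewrite !mevalE; apply: eq_big_seq => m /pY sm.
congr (_ * _); apply: eq_bigr => i _.
by have [/vv'->//|/sm->] := boolP (i \in Y).
Qed.

(** Induction on the number of variables: as a polynomial in [X_j], [p] has too few roots to vanish
    at all constants of a long list, and substituting a constant [t] that is not a root leaves a
    nonzero polynomial in the other variables. *)
Lemma polyin_nonroot (Y : {set 'I_n}) (p : {mpoly F[n]}) :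
  polyin Y p -> p != 0 -> exists v, p.@[v] != 0.
Proof.
have [N] := ubnP #|Y|; elim: N Y p => // N IH Y p YN pY p0.
have [[j jY]|noY] := pselect (exists j, j \in Y); last first.
  exists (fun=> 0); have pC : p = (p@_0)%:MP.
    apply: msize1_polyC; rewrite -mlead_deg//.
    suff -> : mlead p = 0%MM by rewrite mdeg0.
    apply/mnmP => i; rewrite mnm0E; apply: mlead_polyin pY _.
    by apply/negP => iY; apply: noY; exists i.
  by rewrite pC mevalC; apply: contra_neq p0 => p00; rewrite pC p00.
pose Z := Y :\ j; have jZ : j \notin Z by rewrite setD11.
have YE : j |: Z = Y by apply: finset.setD1K.
have [G GZ Gp] : exists2 G : {poly {mpoly F[n]}}, forall i, polyin Z G`_i & G.['X_j] = p.
  by apply: polyin_setU1; rewrite // YE.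
have G0 : G != 0 by apply: contra_neq p0 => G0; rewrite -Gp G0 horner0.
have [r ur sr] := F_infinite (size G).
have [t tr Gt] : exists2 t, t \in r & G.[t%:MP] != 0.
  apply/hasP; apply: contraLR sr => /hasPn Hr; rewrite -ltnNge.
  rewrite -(size_map (@mpolyC n F)); apply: max_poly_roots => //.
    by apply/allP => _ /mapP[t /Hr tr ->]; move: tr; rewrite negbK.
  by rewrite map_inj_uniq// => x y /eqP; rewrite mpolyC_eq => /eqP.
have qZ : polyin Z G.[t%:MP].
  rewrite horner_coef; apply: polyin_sum => i _; apply: polyinM => //.
  by apply: polyinXn; rewrite /polyin /keep comp_mpolyC.
have [|v Hv] := IH Z _ _ qZ Gt.
  by move: YN; rewrite (cardsD1 j) jY.
pose v' i := if i == j then t else v i; exists v'.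
apply: contra_neq Hv => E; rewrite -E -Gp !horner_coef !(raddf_sum (meval _))/=.
apply: eq_bigr => i _; rewrite !(rmorphM (meval _)) !(rmorphXn (meval _))/=.
rewrite mevalC mevalXU /v' eqxx; congr (_ * _).
apply: meval_polyin (GZ i) _ => x; rewrite /Z !inE => /andP[/negPf xj _].
by rewrite xj.
Qed.

Lemma mpoly_nonroot (p : {mpoly F[n]}) : p != 0 -> exists v, p.@[v] != 0.
Proof.
apply: (@polyin_nonroot finset.setT); apply/polyinP => m _ i.
by rewrite finset.in_setT.
Qed.

End NonRoot.

Lemma map_mx_injective (S T : Type) (f : S -> T) m n :
  injective f -> injective (@map_mx S T f m n).
Proof.
move=> finj A B E; apply/matrixP => i j; apply: finj.
by move/matrixP/(_ i j): E; rewrite !mxE.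
Qed.

(** * Fractions and common denominators *)

Section Fractions.
Variables (D : idomainType) (n : nat).
Local Notation F := {fraction D}.
Local Notation toF := (map_mpoly (@tofrac D)).

Lemma fraction_quotient (x : F) :
  exists2 d : D, d != 0 & exists a, x = tofrac a / tofrac d.
Proof.
elim/quotW: x => r; exists r.2; first exact: denom_ratioP.
have d0 : tofrac r.2 != 0 by rewrite tofrac_eq0 denom_ratioP.
exists r.1; apply: (mulIf d0); rewrite divfK//; unlock tofrac.
rewrite -[LHS]FracField.pi_mul; apply/eqmodP => /=.
by rewrite FracField.equivfE/= /FracField.mulf !numden_Ratio
  ?oner_neq0 ?mulr1 ?mulf_neq0 ?denom_ratioP// mulrC.
Qed.

Lemma tofracpC (c : D) : toF c%:MP_[n] = (tofrac c)%:MP_[n].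
Proof. exact: map_mpolyC. Qed.

Lemma tofracpM (p q : {mpoly D[n]}) : toF (p * q) = toF p * toF q.
Proof. exact: (rmorphM toF). Qed.

Lemma tofracpD (p q : {mpoly D[n]}) : toF (p + q) = toF p + toF q.
Proof. exact: (rmorphD toF). Qed.

Lemma mcoeff_tofrac (p : {mpoly D[n]}) m : (toF p)@_m = tofrac p@_m.
Proof. exact: mcoeff_map_mpoly. Qed.

Lemma map_tofrac_inj : injective (toF : {mpoly D[n]} -> {mpoly F[n]}).
Proof.
move=> p q E; apply/mpolyP => m; apply/eqP; rewrite -tofrac_eq.
by rewrite -(mcoeff_tofrac p) -(mcoeff_tofrac q) E.
Qed.

Lemma common_denominator (T : eqType) (r : seq T) (a : T -> {mpoly F[n]}) :
  exists2 d : D, d != 0 & forall x, x \in r -> exists p, (tofrac d)%:MP * a x = toF p.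
Proof.
have one (b : {mpoly F[n]}) : exists2 d : D, d != 0 &
      exists p : {mpoly D[n]}, (tofrac d)%:MP * b = toF p.
  rewrite [b]mpolyE; elim/big_ind: _ => [|u v [d d0 [p E]] [e e0 [q E']]|m _].
  - by exists 1; rewrite ?oner_eq0//; exists 0; rewrite mulr0 rmorph0.
  - exists (d * e); rewrite ?mulf_neq0//; exists (e%:MP * p + d%:MP * q).
    rewrite tofracpD !tofracpM !tofracpC -E -E' tofracM mpolyCM.
    by ring.
  have [d d0 [x E]] := fraction_quotient b@_m.
  exists d => //; exists (x *: 'X_[m]).
  rewrite map_mpolyZ map_mpolyX -scalerAr mul_mpolyC scalerA E divfK//.
  by rewrite tofrac_eq0.
elim: r => [|x r [d d0 H]]; first by exists 1; rewrite ?oner_eq0.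
have [e e0 [p Ep]] := one (a x); exists (d * e); rewrite ?mulf_neq0// => y.
rewrite inE => /predU1P[->|/H[q Eq]].
  by exists (d%:MP * p); rewrite tofracpM tofracpC tofracM -Ep mpolyCM mulrA.
by exists (e%:MP * q); rewrite tofracpM tofracpC tofracM -Eq mpolyCM mulrCA mulrA.
Qed.

Lemma mx_common_denominator t s (A : 'M[{mpoly F[n]}]_(t, s)) :
  exists2 d : D, d != 0 & exists B : 'M[{mpoly D[n]}]_(t, s),
    (tofrac d)%:MP *: A = map_mx toF B.
Proof.
have [d d0 H] := common_denominator (enum {: 'I_t * 'I_s}) (fun ij => A ij.1 ij.2).
exists d => //.
have /choice[B HB] ij : exists p, (tofrac d)%:MP * A ij.1 ij.2 = toF p.
  by apply: (H ij); rewrite mem_enum.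
by exists (\matrix_(i, j) B (i, j)); apply/matrixP => i j; rewrite !mxE -HB.
Qed.

Lemma mx_annZ (S : comNzRingType) t s (A : 'M[S]_(t, s)) (c c' : S) :
  c * c' = 1 -> mx_ann (c *: A) = mx_ann A.
Proof.
move=> cc'; apply/seteqP; split=> a [V EV].
  by exists (c *: V); rewrite EV -scalemxAl -scalemxAr.
exists (c' *: V); rewrite EV -scalemxAl -scalemxAr scalerA [c' * c]mulrC cc'.
by rewrite scale1r.
Qed.

(** Clearing the denominators of [V] shows that the saturated annihilator over [D] is the
    contraction of the annihilator over the fraction field. *)
Lemma mx_ann_fraction t s (A : 'M[{mpoly D[n]}]_(t, s)) p :
  mx_ann (map_mx toF A) (toF p) <-> exists2 c : D, c != 0 & mx_ann A (c%:MP * p).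
Proof.
split=> [[V EV]|[c c0 Hc]].
  have [c c0 [B EB]] := mx_common_denominator V; exists c => //; exists B.
  have E : map_mx toF (c%:MP * p)%:M = map_mx toF (B *m A).
    rewrite map_mxM -EB -scalemxAl -EV map_scalar_mx/= tofracpM tofracpC.
    by rewrite scale_scalar_mx.
  exact: (map_mx_injective map_tofrac_inj E).
have H : mx_ann (map_mx toF A) (toF (c%:MP * p)) by exact: (map_mx_ann toF).
rewrite tofracpM tofracpC in H.
have fc0 : tofrac c != 0 by rewrite tofrac_eq0.
have -> : toF p = ((tofrac c)^-1)%:MP * ((tofrac c)%:MP * toF p).
  by rewrite mulrA -mpolyCM mulVf// mpolyC1 mul1r.
exact: (submoduleZ _ (submodule_mx_ann _) H).
Qed.

End Fractions.
(** A scalar kills [L] exactly when it sends every basis vector into the row image. The map [pi] is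
    a bare function so that [coker_pi] is covered as well. *)
Lemma Ann_presentation (S : comNzRingType) t s (A : 'M[S]_(t, s))
    (L : lmodType S) (pi : 'rV[S]_s -> L) :
  (forall y, exists v, pi v = y) ->
  (forall v, pi v = 0 <-> exists w : 'rV[S]_t, v = w *m A) ->
  (forall a v, pi (a *: v) = a *: pi v) -> Ann L = mx_ann A.
Proof.
move=> piS piK piZ; apply/seteqP; split=> a.
  move=> Ha; have /choice[v Hv] i : exists v : 'rV_t, a *: delta_mx 0 i = v *m A.
    by apply/piK; rewrite piZ.
  exists (\matrix_i v i); apply/row_matrixP => i.
  by rewrite row_mul rowK -Hv rowE mul_mx_scalar.
move=> [V EV] x; have [v <-] := piS x; rewrite -piZ; apply/piK.
by exists (v *m V); rewrite -mulmxA -EV mul_mx_scalar.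
Qed.

Lemma Ann_coker (S : comNzRingType) t s (A : 'M[S]_(t, s)) : Ann (coker A) = mx_ann A.
Proof.
have pi0 : coker_pi A 0 = 0.
  by apply: (addrI (coker_pi A 0)); rewrite -coker_piD !addr0.
apply: (@Ann_presentation _ _ _ _ _ (coker_pi A)).
- by move=> y; elim/coker_ind: y => v; exists v.
- move=> v; rewrite -pi0; split=> [/eqP|H]; first by rewrite coker_pi_eq subr0 => /row_imageP.
  by apply/eqP; rewrite coker_pi_eq subr0; apply/row_imageP.
- exact: coker_piZ.
Qed.

Lemma Ann_ideal (S : comNzRingType) (M : lmodType S) : ideal (Ann M).
Proof.
split=> [x|a u v Hu Hv x]; first by rewrite scale0r.
by rewrite scalerDl -[a *: u]/(a * u) -scalerA Hu Hv scaler0 addr0.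
Qed.

(** * Contraction of ideals to [D[x]] and extension to a specialization *)

Section Contraction.
Variables (D : idomainType) (n : nat).
Local Notation toF := (map_mpoly (@tofrac D)).

Definition contraction (I : set {mpoly {fraction D}[n]}) : set {mpoly D[n]} :=
  [set p | I (toF p)].

Lemma contraction_ideal I : ideal I -> ideal (contraction I).
Proof.
move=> II; split; first by rewrite /contraction/= rmorph0; apply: ideal0.
move=> a u v Iu Iv; rewrite /contraction/= -[a *: u]/(a * u) tofracpD tofracpM.
exact: (idealD II (idealMl _ II Iu) Iv).
Qed.

Lemma mlead_tofrac (p : {mpoly D[n]}) : p != 0 -> toF p != 0 /\ mlead (toF p) = mlead p.
Proof.
move=> p0; apply: mlead_eq; first by rewrite mcoeff_tofrac tofrac_eq0 mleadc_eq0.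
by move=> m lt_m; rewrite mcoeff_tofrac mcoeff_gt_mlead// tofrac0.
Qed.

(** A common denominator moves an element of [I] into [D[x]] without changing its leading
    exponent. *)
Lemma mon_contraction I : ideal I -> lead_exps id (contraction I) = mon I.
Proof.
move=> II; apply/seteqP; split=> m [p [Ip p0 <-]].
  by have [p'0 <-] := mlead_tofrac p0; exists (toF p).
have [d d0 /(_ p (mem_head _ _))[q Eq]] := common_denominator [:: p] id.
have fd0 : tofrac d != 0 by rewrite tofrac_eq0.
have qE : toF q = tofrac d *: p by rewrite -Eq mul_mpolyC.
have q0 : q != 0.
  apply: contraNneq p0 => q0; move: qE; rewrite q0 rmorph0 => /esym/eqP.
  by rewrite mscalerI (negPf fd0).
exists q; split=> //; first by rewrite /contraction/= -Eq; apply: idealMl.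
by have [_ <-] := mlead_tofrac q0; rewrite qE mleadZ.
Qed.

Variables (K : fieldType) (phi : {rmorphism D -> K}).

(** Written as a span to match [generic_lead]; for an ideal [J] it is the generated ideal, by
    [extension_ideal_gen]. *)
Definition extension (J : set {mpoly D[n]}) : set {mpoly K[n]} :=
  @kspan _ _ {mpoly K[n]}^o (map_mpoly phi @` J).

Lemma extension_ideal J : ideal J -> ideal (extension J).
Proof.
move=> JJ; split; first exact: kspan0.
move=> a u v ku kv; apply: kspan_add => //.
rewrite -[a *: u]/(a * u) [a]mpolyE mulr_suml.
apply: (@kspan_sum _ _ {mpoly K[n]}^o) => m _.
rewrite -mul_mpolyC -mulrA; apply: (@kspan_scale _ _ {mpoly K[n]}^o).
apply: (@kspan_image _ _ {mpoly K[n]}^o {mpoly K[n]}^o _ _ (fun u => 'X_[m] * u) _ _ _ _ ku).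
- exact: mulr0.
- by move=> c x y; rewrite mulrDr; congr (_ + _); exact: (mulrCA 'X_[m] c%:MP x).
- move=> _ [p Jp <-]; exists ('X_[m] * p); last by rewrite rmorphM/= map_mpolyX.
  exact: (submoduleZ _ JJ).
Qed.

Lemma extension_ideal_gen J : ideal J ->
  ideal_gen (map_mpoly phi @` J) = extension J.
Proof.
move=> JJ; apply/seteqP; split.
  apply: smallest_sub; first exact: (proj2 (is_idealE _) (extension_ideal JJ)).
  by move=> x Jx; apply: kspan_incl.
move=> x kx I [/is_idealE II JI]; elim: kx => [|c v w Jv _ Iw]; first exact: ideal0.
by apply: idealD => //; apply: idealMl => //; apply: JI.
Qed.

End Contraction.

(** The last two conclusions of [generic_lead], for the identity form on the contraction, are the
    two inclusions. *)
Lemma generic_mon (D : idomainType) n (I : set {mpoly {fraction D}[n]}) : ideal I ->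
  exists2 g : D, g != 0 &
  forall (K : fieldType) (phi : {rmorphism D -> K}), phi g != 0 ->
    mon (extension phi (contraction I)) = mon I.
Proof.
move=> II; have JJ := contraction_ideal II.
have idP (R : comNzRingType) : @scalar_map R R^o id by [].
have [g g0 H] := generic_lead (idP _) JJ; exists g => // K phi phig.
have [|//|_ H1 H2] := H K phi phig {mpoly K[n]}^o (map_mpoly phi) id _ (idP _).
  by move=> a u v; rewrite rmorphD rmorphM.
rewrite -mon_contraction//; apply/seteqP; split=> m.
  by move=> [w [kw w0 <-]]; apply: H1.
move=> /H2[u [Ju u0 um]]; exists (map_mpoly phi u); split=> //.
by apply: kspan_incl; exists u.
Qed.

Section SpecializationTheory.
Variables (k K : fieldType) (iota : {rmorphism k -> K}) (m n : nat).
Variable alpha : 'I_m -> K.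

HB.instance Definition _ := GRing.RMorphism.copy (eval_u iota alpha)
  (mmap (adjoin_base iota alpha) (adjoin_gen iota alpha)).

Lemma eval_uM p q :
  eval_u iota alpha (p * q) = eval_u iota alpha p * eval_u iota alpha q.
Proof. exact: (rmorphM (eval_u iota alpha)). Qed.

Lemma eval_uM_neq0 p q : (eval_u iota alpha (p * q) != 0) =
  (eval_u iota alpha p != 0) && (eval_u iota alpha q != 0).
Proof. by rewrite -negb_or -mulf_eq0 eval_uM. Qed.

(** Relates values in [k(alpha)] to values in [K], through which algebraic sets are defined. *)
Lemma eval_uE q : val (eval_u iota alpha q) = (map_mpoly iota q).@[alpha].
Proof.
pose v : {rmorphism adjoin iota alpha -> K} := val.
rewrite [in RHS](mpolyE q) (raddf_sum (map_mpoly iota)) (raddf_sum (meval alpha)).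
rewrite -[LHS]/(v _) /eval_u /mmap (rmorph_sum v); apply: eq_bigr => e _.
rewrite (rmorphM v) /mmap1 (rmorph_prod v) /= map_mpolyZ map_mpolyX mevalZ mevalX.
by congr (_ * _); apply: eq_bigr => i _; exact: (rmorphXn v).
Qed.

Lemma spec_polyM (p q : {mpoly {mpoly k[m]}[n]}) :
  spec_poly iota alpha (p * q) = spec_poly iota alpha p * spec_poly iota alpha q.
Proof. exact: (rmorphM (map_mpoly (eval_u iota alpha))). Qed.

Lemma spec_polyCM (c : {mpoly k[m]}) (p : {mpoly {mpoly k[m]}[n]}) :
  spec_poly iota alpha (c%:MP * p) = (eval_u iota alpha c)%:MP * spec_poly iota alpha p.
Proof.
apply: etrans (spec_polyM _ _) _; congr (_ * _).
exact: (map_mpolyC n (eval_u iota alpha)).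
Qed.

(** Cross-multiplication turns equality of two fractions into an identity in [k[u][x]], which
    evaluation at [alpha] preserves. *)
Lemma spec_eq (a : genring k m n) (b : specring iota n alpha) :
  is_spec a b -> spec iota alpha a = b.
Proof.
move=> ab; apply: xget_unique => // b'; move: ab.
move=> [p [q [q0 Ea qa Eb]]] [p' [q' [q'0 Ea' q'a Eb']]].
have cancel_denominators (F : fieldType) (c c' : F) (x y : {mpoly F[n]}) : c != 0 -> c' != 0 ->
    (c^-1)%:MP * x = (c'^-1)%:MP * y <-> c'%:MP * x = c%:MP * y.
  move=> c0 c'0; split=> E.
    rewrite -[x]mul1r -(mpolyC1 n F) -(divff c0) mpolyCM -mulrA E.
    by rewrite mulrCA [c'%:MP * _]mulrA -mpolyCM divff// mpolyC1 mul1r.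
  rewrite -[x]mul1r -(mpolyC1 n F) -(mulVf c'0) mpolyCM -mulrA E.
  by rewrite mulrCA [(c^-1)%:MP * _]mulrA -mpolyCM mulVf// mpolyC1 mul1r.
have fq0 : tofrac q != 0 by rewrite tofrac_eq0.
have fq'0 : tofrac q' != 0 by rewrite tofrac_eq0.
have E : q'%:MP * p = q%:MP * p'.
  apply: map_tofrac_inj; rewrite !tofracpM !tofracpC.
  exact: (proj1 (cancel_denominators _ _ _ _ _ fq0 fq'0) (etrans (esym Ea) Ea')).
rewrite Eb Eb'; apply: esym; apply: (proj2 (cancel_denominators _ _ _ _ _ qa q'a)).
exact: (etrans (esym (spec_polyCM q' p)) (etrans (congr1 _ E) (spec_polyCM q p'))).
Qed.

End SpecializationTheory.

(** The exceptional set is the zero set of the image of [g] over [K]. It is proper because [K]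
    contains the infinite field [k], so a nonzero polynomial has a nonroot. *)
Lemma almost_all_nonzero (k K : fieldType) (iota : {rmorphism k -> K}) m
    (g : {mpoly k[m]}) (P : ('I_m -> K) -> Prop) :
  infinite_set [set: k] -> g != 0 ->
  (forall alpha, eval_u iota alpha g != 0 -> P alpha) -> almost_all P.
Proof.
move=> kinf g0 HP; pose f := map_mpoly iota g.
have f0 : f != 0.
  apply: contraNneq g0 => f0; apply/eqP/mpolyP => e; apply: (fmorph_inj iota).
  by rewrite mcoeff0 rmorph0 -(mcoeff_map_mpoly iota) -/f f0 mcoeff0.
have Kinf N : exists2 r : seq K, uniq r & (N <= size r)%N.
  have [B _ NB] := infinite_set_fset N kinf.
  exists [seq iota x | x <- finmap.enum_fset B]; last by rewrite size_map.
  by rewrite map_inj_uniq ?finmap.fset_uniq//; apply: fmorph_inj.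
exists [set f]; split.
  have [v fv] := mpoly_nonroot Kinf f0.
  by move=> /seteqP[_ /(_ v I f erefl)] /eqP; rewrite (negPf fv).
move=> alpha nf; apply: HP; apply: contra_notN nf => /eqP ga _ ->.
by rewrite -eval_uE ga.
Qed.

(** By [chainE] the lengths of chains depend only on the leading exponents, which can be compared
    across different fields. *)
Lemma has_prime_chain_mon (F F' : fieldType) n (I : set {mpoly F[n]})
    (J : set {mpoly F'[n]}) :
  ideal I -> ideal J -> mon I = mon J ->
  has_prime_chain I = has_prime_chain J :> set nat.
Proof.
move=> II JJ IJ; apply/seteqP; split=> l /has_prime_chainE cl; apply/has_prime_chainE.
  by apply/chainE => //; rewrite -IJ; apply/chainE.
by apply/chainE => //; rewrite IJ; apply/chainE.
Qed.

Theorem theorem3p4 (k K : fieldType) (iota : {rmorphism k -> K}) (m n : nat)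
    (k_infinite : infinite_set [set: k])
    (L : lmodType (genring k m n)) (t s : nat)
    (A : 'M[genring k m n]_(t, s))
    (pi : {linear 'rV[genring k m n]_s -> L})
    (presL : is_presentation A pi) :
  almost_all (fun alpha : 'I_m -> K =>
    [/\ spec_mx_defined iota alpha A,
        Ann (spec_module iota alpha A) = spec_ideal iota alpha (Ann L) &
        module_dim (spec_module iota alpha A) = module_dim L]).
Proof.
have [piS piK] := presL.
have AnnL : Ann L = mx_ann A.
  by apply: (Ann_presentation piS piK) => a v; rewrite linearZ.
have II : ideal (Ann L) by apply: Ann_ideal.
have [d d0 [B EB]] := mx_common_denominator A.
have fd0 : tofrac d != 0 by rewrite tofrac_eq0.
have AnnB : Ann L = mx_ann (map_mx (map_mpoly (@tofrac {mpoly k[m]})) B).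
  have dd : (tofrac d)%:MP * ((tofrac d)^-1)%:MP = 1 :> {mpoly {fraction {mpoly k[m]}}[n]}.
    by rewrite -mpolyCM divff// mpolyC1.
  by rewrite AnnL -EB (mx_annZ _ dd).
have AE i j : A i j = ((tofrac d)^-1)%:MP * poly_in_genring (B i j).
  have : ((tofrac d)%:MP *: A) i j = poly_in_genring (B i j) by rewrite EB mxE.
  by rewrite mxE => <-; rewrite mulrA -mpolyCM mulVf// mpolyC1 mul1r.
have [g1 g10 H1] := generic_annihilator B.
have [g2 g20 H2] := generic_mon II.
(* The factor [d] keeps [A] defined, [g1] controls the annihilator and [g2] the leading
   exponents. *)
apply: (@almost_all_nonzero _ _ _ _ (d * (g1 * g2))) => //; first by rewrite !mulf_neq0.
move=> alpha; rewrite !eval_uM_neq0 => /and3P[phid phi1 phi2].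
have specA i j :
    is_spec (A i j) (((eval_u iota alpha d)^-1)%:MP * spec_poly iota alpha (B i j)).
  by exists (B i j), d; split; [exact: d0 | exact: AE | exact: phid | exact: erefl].
have AnnLa : Ann (spec_module iota alpha A) =
    extension (eval_u iota alpha) (contraction (Ann L)).
  apply: etrans (Ann_coker _) _.
  have -> : spec_mx iota alpha A = ((eval_u iota alpha d)^-1)%:MP *:
      map_mx (map_mpoly (eval_u iota alpha)) B.
    by apply/matrixP => i j; rewrite !mxE (spec_eq (specA i j)).
  have dd : ((eval_u iota alpha d)^-1)%:MP * (eval_u iota alpha d)%:MP = 1
      :> {mpoly (adjoin iota alpha)[n]} by rewrite -mpolyCM mulVf// mpolyC1.
  rewrite (mx_annZ _ dd).
  (* This matches the saturation in [generic_annihilator] with the generators of the specialized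
     ideal. *)
  have -> : contraction (Ann L) = [set p | exists2 c, c != 0 & mx_ann B (c%:MP * p)].
    by rewrite AnnB; apply/seteqP; split=> p /mx_ann_fraction.
  by apply/seteqP; split=> a /(H1 _ _ phi1).
split.
  move=> i j.
  by exists (((eval_u iota alpha d)^-1)%:MP * spec_poly iota alpha (B i j)).
  apply: etrans AnnLa _; apply: esym.
  exact: (extension_ideal_gen (eval_u iota alpha) (contraction_ideal II)).
have monE := etrans (congr1 (@mon _ n) AnnLa) (H2 _ _ phi2).
have IIa : ideal (Ann (spec_module iota alpha A)) by apply: Ann_ideal.
have chE := has_prime_chain_mon IIa II monE.
exact: (congr1 (fun X => supremum -oo%E [set (l%:Z)%:E%E | l in X]) chE).
Qed.
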